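(* Let $\omega=(w_1,\dots,w_n)$ be any probability vector, $0<\alpha\le1$ and $A_1,\dots,A_n\in\mathbb{P}$. For any $r\ge1$, $$P_{\omega,\alpha}(A_1^r,\dots,A_n^r)\ge\lambda_{\min}(P_{\omega,\alpha}(A_1,\dots,A_n))^{r-1}P_{\omega,\alpha}(A_1,\dots,A_n),$$ $$P_{\omega,-\alpha}(A_1^r,\dots,A_n^r)\le\|P_{\omega,-\alpha}(A_1,\dots,A_n)\|_\infty^{r-1}P_{\omega,-\alpha}(A_1,\dots,A_n),$$ and for any $r\in(0,1]$, $$P_{\omega,\alpha}(A_1^r,\dots,A_n^r)\le\lambda_{\min}(P_{\omega,\alpha}(A_1,\dots,A_n))^{r-1}P_{\omega,\alpha}(A_1,\dots,A_n),$$ $$P_{\omega,-\alpha}(A_1^r,\dots,A_n^r)\ge\|P_{\omega,-\alpha}(A_1,\dots,A_n)\|_\infty^{r-1}P_{\omega,-\alpha}(A_1,\dots,A_n).$$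
   Context: $\mathcal{H}$ is an infinite-dimensional Hilbert space and $\mathbb{P}=\mathbb{P}(\mathcal{H})$ is the set of positive invertible bounded operators on $\mathcal{H}$, with the usual operator order $\le$. For $X\in\mathbb{P}$, $\|X\|_\infty$ is the operator norm and $\lambda_{\min}(X)$ is the minimum of the spectrum of $X$. A probability vector is $\omega=(w_1,\dots,w_n)$ with $w_j\ge0$, $\sum_jw_j=1$. Weighted geometric mean: $A\#_\alpha B:=A^{1/2}(A^{-1/2}BA^{-1/2})^\alpha A^{1/2}$ for $A,B\in\mathbb{P}$, $0\le\alpha\le1$. Power means: for $\alpha\in[-1,1]\setminus\{0\}$, $P_{\omega,\alpha}(A_1,\dots,A_n)$ is the unique $X\in\mathbb{P}$ (which exists) with $X=\sum_{j=1}^nw_j(X\#_\alpha A_j)$ if $0<\alpha\le1$, and with $X=\bigl(\sum_{j=1}^nw_j(X\#_{-\alpha}A_j)^{-1}\bigr)^{-1}$ if $-1\le\alpha<0$. *)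

(* Defs.v *)
From HB Require Import structures.
From mathcomp Require Import all_boot all_order all_algebra.
From mathcomp Require Import all_classical all_reals all_analysis.
From mathcomp Require Import complex.

Set Implicit Arguments.
Unset Strict Implicit.
Unset Printing Implicit Defensive.

Import Order.TTheory GRing.Theory Num.Theory.
Import numFieldNormedType.Exports.

Local Open Scope classical_set_scope.
Local Open Scope ring_scope.
Local Open Scope complex_scope.

(* A complex Hilbert space is a Banach space [H] over [R[i]] whose norm comes
   from an inner product (linear in its first argument). Operators on [H] are
   plain functions [H -> H], restricted by the predicates below. The order of
   [R[i]] is the partial one: [0 <= z] means that [z] is real and
   nonnegative. *)

Section Operators.
Context {R : realType} {H : completeNormedModType R[i]}.
Implicit Types (A B X : H -> H) (ip : {dot H for Num.conj}).

Definition norm_of_inner_product ip : Prop :=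
  forall x : H, ip x x = `|x| ^+ 2.

Definition bounded_operator A : Prop :=
  linear A /\ exists M : R[i], forall x, `|A x| <= M * `|x|.

Definition is_inverse A B : Prop :=
  [/\ bounded_operator B, A \o B = id & B \o A = id].

Definition invertible A : Prop := exists B, is_inverse A B.

Definition opinv A : H -> H := xget (id : H -> H) [set B | is_inverse A B].

Definition positive_operator ip A : Prop :=
  forall x, 0 <= ip (A x) x.

Definition op_le ip A B : Prop := positive_operator ip (fun x => B x - A x).

Definition pos_invertible ip A : Prop :=
  [/\ bounded_operator A, positive_operator ip A & invertible A].

Definition opnorm A : R :=
  sup [set complex.Re `|A x| | x in [set x : H | `|x| <= 1]].

Definition spectrum A : set R[i] :=
  [set z | ~ invertible (fun x => A x - z *: x)].

Definition lambda_min A : R :=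
  xget 0 [set m : R | spectrum A m%:C /\
                      forall z, spectrum A z -> m%:C <= z].

Definition op_poly (p : {poly R}) A : H -> H :=
  fun x => \sum_(i < size p) (p`_i)%:C *: iter i A x.

(* Continuous functional calculus of an operator with real spectrum: [f(A)] is
   the norm limit of [p_n(A)] for polynomials [p_n] converging to [f]
   uniformly on the spectrum of [A]. *)
Definition is_functional_calculus A (f : R -> R) B : Prop :=
  bounded_operator B /\
  exists p : nat -> {poly R},
    {uniform [set t : R | spectrum A t%:C],
       (fun (k : nat) (t : R) => (p k).[t]) @ \oo --> f} /\
    (fun k : nat => opnorm (fun x => op_poly (p k) A x - B x)) @ \oo
      --> (0 : R).

Definition functional_calculus A (f : R -> R) : H -> H :=
  xget (id : H -> H) [set B | is_functional_calculus A f B].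

Definition oppow A (r : R) : H -> H :=
  functional_calculus A (fun t => t `^ r).

Definition geometric_mean (alpha : R) A B : H -> H :=
  oppow A 2^-1
    \o oppow (oppow A (- 2^-1) \o B \o oppow A (- 2^-1)) alpha
    \o oppow A 2^-1.

Definition power_mean_equation n (w : 'I_n -> R) (alpha : R)
    (A : 'I_n -> H -> H) X : Prop :=
  if 0 < alpha then
    X = (fun x => \sum_(j < n) (w j)%:C *: geometric_mean alpha X (A j) x)
  else
    X = opinv (fun x => \sum_(j < n)
                 (w j)%:C *: opinv (geometric_mean (- alpha) X (A j)) x).

(* [id] is only a default value: for [-1 <= alpha <= 1], [alpha <> 0],
   a probability vector [w] and
   positive invertible [A j], the equation has exactly one solution among the
   positive invertible operators. *)
Definition power_mean ip n (w : 'I_n -> R) (alpha : R)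
    (A : 'I_n -> H -> H) : H -> H :=
  xget (id : H -> H) [set X | pos_invertible ip X /\ power_mean_equation w alpha A X].

End Operators.

Definition infinite_dimensional {K : numFieldType} (V : lmodType K) : Prop :=
  forall s : seq V, exists x : V,
    forall c : nat -> K, x <> \sum_(i < size s) c i *: s`_i.

Definition probability_vector {R : realType} n (w : 'I_n -> R) : Prop :=
  (forall j, 0 <= w j) /\ \sum_(j < n) w j = 1.

(* Main.v *)
(* For 0 < alpha <= 1 the power mean P(A) is the fixed point of
   f_A(X) = sum_j w_j (X #_alpha A_j). This map is monotone and homogeneous of
   degree 1 - alpha < 1, so iterating it from a large scalar converges, and
   X <= f_A(X) implies X <= P(A), f_A(X) <= X implies P(A) <= X. It is
   therefore enough to compare Z = lambda^(r-1) X with f_{A^r}(Z), where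
   X = P(A) >= lambda. For r <= 1, monotonicity of # in its first argument gives
   lambda^(1-r) A_j^r <= X #_r A_j, whence X #_alpha A_j^r is at most
   lambda^(alpha (r-1)) X #_{alpha r} A_j, and X #_{alpha r} A_j is at most
   (1-r) X + r (X #_alpha A_j) by Young's inequality; for r >= 1 apply the same
   estimates to the exponent 1/r and to A_j^r. The case -alpha follows from
   P_{-alpha}(A) = P_alpha(A^-1)^-1, with lambda = 1 / ||P_{-alpha}(A)||.

   The two operator inequalities behind this are that t |-> t^s is operator
   monotone for 0 <= s <= 1 (Loewner-Heinz, by Pedersen's argument) and
   X #_alpha B = B^(1/2) (B^(1/2) X^-1 B^(1/2))^(alpha-1) B^(1/2), which
   makes # monotone in X. For the functional calculus, the infimum of the
   numerical range of a self-adjoint operator belongs to its spectrum; factoring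
   a polynomial over R[i] then shows that p(A) >= 0 as soon as p >= 0 on the
   spectrum of A. *)

Require Import Defs.
From HB Require Import structures.
From mathcomp Require Import all_boot all_order all_algebra.
From mathcomp Require Import all_classical all_reals all_analysis.
From mathcomp Require Import complex.
From mathcomp Require Import ring lra zify.
Import Order.TTheory GRing.Theory Num.Theory.
Import numFieldNormedType.Exports.
Local Open Scope ring_scope.
Local Open Scope complex_scope.

Set Implicit Arguments.
Unset Strict Implicit.
Unset Printing Implicit Defensive.

(** * Polynomial approximation of powers *)

Section PolynomialApproximation.
Context {R : realType}.
Implicit Types (a b c e m q r s t u x M L : R) (p : {poly R}) (f : R -> R) (g h : nat -> R).

(** Everything is derived from the operator order: a norm bound on a self-adjoint operator is read
    off from two scalar bounds -e and e. Powers with negative exponents are singular at 0, so each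
    operator is first enclosed between two positive scalars, and t^r is approximated by polynomials
    on that compact interval only. The fixed-point arguments compare operators through ratios t with
    X <= t Y. Monotonicity and homogeneity of degree q = 1 - alpha turn the ratio t into t^q, and
    t^(q^k) tends to 1. This one mechanism gives the rate of convergence of the iteration,
    identifies its limit, and compares any sub- or superfixed point with a fixed point. The
    Loewner-Heinz and Young inequalities hold for exponents in [0, 1], which forces the passage to
    1/r when r >= 1. The price is a term (1 - 1/r) X on the larger side; it is subtracted from X, so
    the scalar factor has to be kept away from it. The comparison holds for every positive
    invertible solution of the power mean equation, hence for the one that [xget] selects. *)

Lemma natSinv_small e : 0 < e ->
  exists N : nat, forall n, (N <= n)%N -> (n.+1%:R^-1 : R) <= e.
Proof.
move=> e0; have [N _ hN] := near_infty_natSinv_lt (PosNum e0).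
by exists N => n hn; apply/ltW; exact: hN.
Qed.

Definition poly_approx m M f :=
  forall e, 0 < e -> exists p, forall t, m <= t <= M -> `|p.[t] - f t| <= e.

(* The value of [bernstein n g] at [x] is the mean of [g (S_n)], where [S_n]
   counts the successes in [n] independent trials of probability [x]. *)
Fixpoint bernstein n g : {poly R} :=
  if n is n'.+1 then
    'X * bernstein n' (fun k => g k.+1) + (1 - 'X) * bernstein n' g
  else (g 0%N)%:P.

(** At a point of [0, 1] every step of the recursion is a convex combination. This lets quadratic
    bounds on the node values pass to the polynomial. *)
Lemma bernstein_le n g h x : 0 <= x <= 1 ->
  (forall k, (k <= n)%N -> g k <= h k) -> (bernstein n g).[x] <= (bernstein n h).[x].
Proof.
move=> /andP[x0 x1]; elim: n g h => [|n ih] g h gh /=; first by rewrite !hornerC gh.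
rewrite !hornerE /=; apply: lerD; apply: ler_wpM2l => //; last first.
- by apply: ih => k kn; apply: gh; rewrite ltnW.
- lra.
- by apply: ih => k kn; apply: gh.
Qed.

(** Squared bias plus the variance n x (1 - x) of [S_n]. The centre c is general because the shift
    in the recursion replaces it by c - 1. *)
Lemma bernstein_quadratic n a b c x :
  (bernstein n (fun k => a + b * (k%:R - c) ^+ 2)).[x] =
  a + b * ((n%:R * x - c) ^+ 2 + n%:R * x * (1 - x)).
Proof.
elim: n c => [|n ih] c /=; first by rewrite hornerC; ring.
have -> : bernstein n (fun k => a + b * (k.+1%:R - c) ^+ 2) =
          bernstein n (fun k => a + b * (k%:R - (c - 1)) ^+ 2).
  by congr bernstein; apply: funext => k; rewrite -natr1; congr (_ + _ * _ ^+ 2); ring.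
rewrite !hornerE /= !ih -natr1; ring.
Qed.

Lemma poly_approx_lipschitz m M L f : m < M -> 0 <= L ->
  (forall s t, m <= s <= M -> m <= t <= M -> `|f s - f t| <= L * `|s - t|) ->
  poly_approx m M f.
Proof.
move=> mM L0 hL e e0.
pose K := L * (M - m).
have K0 : 0 <= K by rewrite mulr_ge0 //; lra.
have K1 : 0 < K + 1 by lra.
have [N hN] := natSinv_small (divr_gt0 e0 K1).
(* The error decreases like the inverse square root of the number of trials; taking a square for n
   makes that root equal to D. *)
pose D : R := N.+1%:R; pose n := (N.+1 ^ 2)%N.
have D0 : 0 < D by rewrite ltr0Sn.
have nE : n%:R = D ^+ 2 by rewrite natrX.
have DK : K / D <= e.
  have := hN N (leqnn _); rewrite -/D ler_pdivlMr // => h.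
  apply: le_trans h; rewrite mulrC ler_wpM2l ?invr_ge0 ?ltW //; lra.
pose node k : R := m + (M - m) * (k%:R / n%:R).
exists (bernstein n (f \o node) \Po ((M - m)^-1 *: ('X - m%:P))) => t /andP[mt tM].
rewrite horner_comp hornerZ hornerXsubC; set x := _ * _.
have d0 : 0 < M - m by lra.
have xI : 0 <= x <= 1.
  apply/andP; split; first by rewrite mulr_ge0 ?invr_ge0; lra.
  by rewrite /x mulrC ler_pdivrMr // mul1r; lra.
have tE : t = m + (M - m) * x by rewrite /x; field; lra.
have nodeI k : (k <= n)%N -> m <= node k <= M.
  move=> kn; have n0 : 0 < n%:R :> R by rewrite nE exprn_gt0.
  have k0 : 0 <= k%:R / n%:R :> R by rewrite divr_ge0.
  have k1 : k%:R / n%:R <= 1 :> R by rewrite ler_pdivrMr // mul1r ler_nat.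
  have := mulr_ge0 (ltW d0) k0; have := ler_wpM2l (ltW d0) k1; rewrite /node; lra.
(* 2 D |u| <= 1 + (D |u|)^2, which leaves only the variance to be computed. *)
have key k : (k <= n)%N ->
    `|f (node k) - f t| <= K / (2 * D) + K / (2 * D ^+ 3) * (k%:R - n%:R * x) ^+ 2.
  move=> kn; have tI : m <= t <= M by rewrite mt.
  apply: le_trans (hL _ _ (nodeI k kn) tI) _.
  pose u := (k%:R - n%:R * x) / n%:R.
  have -> : node k - t = (M - m) * u.
    by rewrite tE /node /u; field; rewrite nE expf_neq0 // gt_eqF.
  rewrite normrM (gtr0_norm d0) mulrA -/K.
  have -> : K / (2 * D) + K / (2 * D ^+ 3) * (k%:R - n%:R * x) ^+ 2 =
            K * ((1 + (D * `|u|) ^+ 2) / (2 * D)).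
    by rewrite exprMn real_normK ?num_real // /u nE; field; rewrite gt_eqF.
  apply: ler_wpM2l => //; rewrite ler_pdivlMr; last lra.
  have := sqr_ge0 (1 - D * `|u|); lra.
pose B := K / (2 * D); pose C := K / (2 * D ^+ 3).
have val : B + C * ((n%:R * x - n%:R * x) ^+ 2 + n%:R * x * (1 - x)) <= e.
  apply: le_trans DK.
  have -> : B + C * ((n%:R * x - n%:R * x) ^+ 2 + n%:R * x * (1 - x)) =
    K / D * ((1 + x * (1 - x)) / 2) by rewrite /B /C nE; field; rewrite gt_eqF.
  rewrite -[leRHS]mulr1; apply: ler_wpM2l; first by rewrite divr_ge0 // ltW.
  by move/andP: xI => [x0 x1]; nra.
have C0 : 0 <= C by rewrite divr_ge0 // mulr_ge0 // exprn_ge0 // ltW.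
have up : (bernstein n (f \o node)).[x] <= f t + e.
  have := @bernstein_le n (f \o node) (fun k => (f t + B) + C * (k%:R - n%:R * x) ^+ 2) x xI.
  rewrite bernstein_quadratic => /(_ _) h; apply: le_trans (h _) _; last lra.
  by move=> k kn /=; have := key k kn; rewrite ler_norml; rewrite -/B -/C; lra.
have lo : f t - e <= (bernstein n (f \o node)).[x].
  have := @bernstein_le n (fun k => (f t - B) + (- C) * (k%:R - n%:R * x) ^+ 2) (f \o node) x xI.
  rewrite bernstein_quadratic => /(_ _) h; apply: le_trans (h _); first lra.
  by move=> k kn /=; have := key k kn; rewrite ler_norml; rewrite -/B -/C; lra.
by rewrite ler_norml; lra.
Qed.

Lemma powRE t r : 0 < t -> t `^ r = expR (r * ln t).
Proof. by move=> t0; rewrite /powR gt_eqF. Qed.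

Lemma ln_lipschitz m s t : 0 < m -> m <= s -> m <= t -> ln s - ln t <= `|s - t| / m.
Proof.
move=> m0 ms mt; have s0 : 0 < s by lra. have t0 : 0 < t by lra.
rewrite -ln_div ?posrE //.
have -> : s / t = 1 + (s - t) / t by field; rewrite gt_eqF.
apply: (@le_trans _ _ ((s - t) / t)).
  apply: le_ln1Dx; rewrite ltr_pdivlMr //; lra.
apply: (@le_trans _ _ (`|s - t| / t)).
  by rewrite ler_wpM2r ?ler_norm // invr_ge0 ltW.
by rewrite ler_wpM2l // lef_pV2 ?posrE.
Qed.

(** The bound depends on r through its absolute value, so it also bounds t^(-r) and yields the lower
    bound in [powR_range]. *)
Lemma powR_bound m M t r : 0 < m -> m <= t <= M ->
  t `^ r <= expR (`|r| * (`|ln m| + `|ln M|)).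
Proof.
move=> m0 /andP[mt tM]; have t0 : 0 < t by lra.
rewrite powRE // ler_expR; apply: le_trans (ler_norm _) _.
rewrite normrM ler_wpM2l // ler_norml.
have h1 : ln m <= ln t by rewrite ler_ln ?posrE //.
have h2 : ln t <= ln M by rewrite ler_ln ?posrE //; lra.
have := ler_norm (ln M); have := ler_norm (- ln m); rewrite normrN.
have := normr_ge0 (ln m); have := normr_ge0 (ln M).
lra.
Qed.

Lemma poly_approx_powR m M r : 0 < m -> poly_approx m M (fun t => t `^ r).
Proof.
move=> m0.
(* [poly_approx_lipschitz] needs a nondegenerate interval whereas M is arbitrary, so the interval is
   enlarged. *)
have sub M' : M <= M' -> poly_approx m M' (fun t => t `^ r) -> poly_approx m M (fun t => t `^ r).
  move=> MM h e /h[p hp]; exists p => t /andP[mt tM]; apply: hp.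
  by rewrite mt /=; lra.
pose M' := `|M| + m + 1.
have MM' : M <= M' by have := ler_norm M; rewrite /M'; lra.
have mM' : m < M' by have := normr_ge0 M; rewrite /M'; lra.
apply: (sub M' MM').
pose B := expR (`|r| * (`|ln m| + `|ln M'|)).
have B0 : 0 <= B by exact: expR_ge0.
apply: (@poly_approx_lipschitz _ _ (B * (`|r| / m))) => //.
  by rewrite mulr_ge0 // divr_ge0 // ltW.
have one s t : m <= s <= M' -> m <= t <= M' -> s `^ r - t `^ r <= B * (`|r| / m) * `|s - t|.
  move=> sI tI; have sB := powR_bound r m0 sI.
  have /andP[ms _] := sI; have /andP[mt _] := tI.
  have s0 : 0 < s by lra. have t0 : 0 < t by lra.
  (* The inequality 1 + x <= e^x at x = r (ln t - ln s) covers both signs of r. *)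
  have h : s `^ r - t `^ r <= s `^ r * (r * (ln s - ln t)).
    have -> : t `^ r = s `^ r * expR (r * (ln t - ln s)).
      by rewrite !powRE // -expRD; congr expR; ring.
    have := expR_ge1Dx (r * (ln t - ln s)); have := powR_ge0 s r => ? ?.
    have : s `^ r * (1 + r * (ln t - ln s)) <= s `^ r * expR (r * (ln t - ln s)).
      exact: ler_wpM2l.
    lra.
  apply: (le_trans h).
  have h2 : r * (ln s - ln t) <= `|r| * (`|s - t| / m).
    apply: le_trans (ler_norm _) _; rewrite normrM ler_wpM2l // ler_norml.
    have := ln_lipschitz m0 mt ms; have := ln_lipschitz m0 ms mt.
    rewrite [`|t - s|]distrC; lra.
  have -> : B * (`|r| / m) * `|s - t| = B * (`|r| * (`|s - t| / m)) by ring.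
  apply: (@le_trans _ _ (s `^ r * (`|r| * (`|s - t| / m)))).
    by rewrite ler_wpM2l // powR_ge0.
  by rewrite ler_wpM2r // mulr_ge0 // divr_ge0 // ltW.
move=> s t sI tI; rewrite ler_norml one // andbT lerNl opprB distrC; exact: one.
Qed.

(** With u = ln t and after division by e^(s u), this is 1 + x <= e^x at -s u and u - s u, whose
    mean with weights 1 - s and s is 0. *)
Lemma powR_young s t : 0 <= s <= 1 -> 0 < t -> t `^ s <= 1 - s + s * t.
Proof.
move=> /andP[s0 s1] t0; rewrite powRE //; set u := ln t.
have -> : t = expR (s * u) * expR (u - s * u) by rewrite -expRD addrC subrK lnK.
have -> : 1 - s + s * (expR (s * u) * expR (u - s * u)) =
  expR (s * u) * ((1 - s) * expR (- (s * u)) + s * expR (u - s * u)).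
  have : expR (s * u) * expR (- (s * u)) = 1 by rewrite -expRD subrr expR0.
  move=> e; rewrite -[in LHS](mulr1 (1 - s)) -e; ring.
rewrite -[leLHS]mulr1 ler_wpM2l ?expR_ge0 //.
have h1 := expR_ge1Dx (- (s * u)); have h2 := expR_ge1Dx (u - s * u).
have s1' : 0 <= 1 - s by lra.
have := ler_wpM2l s1' h1; have := ler_wpM2l s0 h2; lra.
Qed.

Lemma powR_range m M r : 0 < m ->
  exists m' M', 0 < m' /\ forall t, m <= t <= M -> m' <= t `^ r <= M'.
Proof.
move=> m0; pose B := expR (`|r| * (`|ln m| + `|ln M|)).
exists B^-1, B; split; first by rewrite invr_gt0 expR_gt0.
move=> t tI; rewrite (powR_bound r m0 tI) andbT.
have := powR_bound (- r) m0 tI; rewrite normrN -/B powRN => h.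
have t0 : 0 < t by case/andP: tI => mt _; lra.
by rewrite -[leRHS]invrK lef_pV2 // posrE ?expR_gt0 // invr_gt0 powR_gt0.
Qed.

End PolynomialApproximation.

(** * The Hilbert space norm as a real number *)

Section RealNorm.
Context {R : realType} {H : completeNormedModType R[i]}.
Implicit Types (x y : H) (c : R).

(** The norm of H takes values in [R[i]], whose order is partial; its real part puts estimates into
    the ordered field R. *)
Definition rnorm x : R := complex.Re `|x|.

Lemma rnormE x : `|x| = (rnorm x)%:C.
Proof. by rewrite /rnorm RRe_real // ger0_real. Qed.

Lemma rnorm_ge0 x : 0 <= rnorm x.
Proof. by rewrite -ler0c -rnormE. Qed.

Lemma rnormD x y : rnorm (x + y) <= rnorm x + rnorm y.
Proof. by rewrite -lecR rmorphD /= -!rnormE ler_normD. Qed.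

Lemma rnormN x : rnorm (- x) = rnorm x.
Proof. by rewrite /rnorm normrN. Qed.

Lemma rnormZ c x : rnorm (c%:C *: x) = `|c| * rnorm x.
Proof.
apply: complexI; rewrite -rnormE normrZ rmorphM /= -rnormE; congr (_ * _).
by rewrite normc_def /= expr0n /= addr0 sqrtr_sqr.
Qed.

Lemma rnorm0 : rnorm (0 : H) = 0.
Proof. by rewrite /rnorm normr0. Qed.

Lemma rnorm0_eq0 x : rnorm x = 0 -> x = 0.
Proof. by move=> e; apply/eqP; rewrite -normr_eq0 rnormE e. Qed.

Lemma rnorm_complete (u : nat -> H) :
  (forall e : R, 0 < e -> exists N, forall m n, (N <= m)%N -> (N <= n)%N ->
     rnorm (u m - u n) <= e) ->
  exists l, forall e : R, 0 < e -> exists N, forall n, (N <= n)%N ->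
     rnorm (u n - l) <= e.
Proof.
move=> hu.
have cu : cvg (u @ \oo)%classic.
  apply/cauchy_cvgP/cauchy_ballP => e e0.
  have e0' : 0 < complex.Re e by case: e e0 => a b; rewrite ltcE /= => /andP[].
  have eE : e = (complex.Re e)%:C by rewrite RRe_real // gtr0_real.
  have [N hN] := hu (complex.Re e / 2) (divr_gt0 e0' (ltr0Sn _ 1)).
  rewrite near_map2; near=> m n.
  rewrite -ball_normE /= rnormE eE ltcR.
  apply: le_lt_trans (hN m n _ _) _; last by lra.
  - by near: m; exists N.
  - by near: n; exists N.
exists (lim (u @ \oo)%classic) => e e0.
have e0' : 0 < e%:C by rewrite ltcR.
move/cvgrPdist_le : cu => /(_ e%:C e0') [N _ hN].
exists N => n hn; have := hN n hn.
by rewrite rnormE lecR -rnormN opprB.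
Unshelve. all: by end_near.
Qed.

End RealNorm.

(** * The algebra of bounded operators *)

Section BoundedOperators.
Context {R : realType} {H : completeNormedModType R[i]}.

(* The parameter [hn] only ensures [1 != 0], so that operators form an
   [nzRingType] and polynomials can be evaluated at them. *)
Record bop (hn : exists x : H, x != 0) :=
  Bop { bfun :> H -> H; bopP : bounded_operator bfun }.

Context (hn : exists x : H, x != 0).
Local Notation E := (bop hn).
Implicit Types (a b : E) (A B : H -> H) (c : R).

Lemma bop_ext a b : (forall x, a x = b x) -> a = b.
Proof.
case: a b => [A pA] [B pB] /= h.
have e : A = B by apply: funext.
by subst B; congr Bop; apply: Prop_irrelevance.
Qed.

Lemma bounded_nr A : (exists M : R[i], forall x, `|A x| <= M * `|x|) <->
  exists2 M : R, 0 <= M & forall x, rnorm (A x) <= M * rnorm x.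
Proof.
split=> [[M hM]|[M _ hM]]; last first.
  by exists M%:C => x; rewrite !rnormE -rmorphM lecR.
case: M hM => p q hM; exists `|p|; first exact: normr_ge0.
move=> x; have := hM x; rewrite !rnormE; simpc => /andP[_ h].
apply: (le_trans h).
by rewrite ler_wpM2r ?rnorm_ge0 // ler_norm.
Qed.

Lemma bounded_operatorP A : bounded_operator A <->
  linear A /\ exists2 M : R, 0 <= M & forall x, rnorm (A x) <= M * rnorm x.
Proof. by rewrite /bounded_operator bounded_nr. Qed.

Lemma bop_linear a : linear a. Proof. by case: (bopP a). Qed.
HB.instance Definition _ a :=
  GRing.isLinear.Build R[i] H H *:%R (bfun a) (@bop_linear a).

Lemma bop_bound a : exists2 M : R, 0 <= M & forall x, rnorm (a x) <= M * rnorm x.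
Proof. by case/bounded_operatorP: (bopP a). Qed.

HB.instance Definition _ := gen_eqMixin E.
HB.instance Definition _ := gen_choiceMixin E.

Lemma bounded_zero : bounded_operator (fun _ : H => 0 : H).
Proof.
apply/bounded_operatorP; split; first by move=> k x y; rewrite scaler0 addr0.
by exists 0 => // x; rewrite rnorm0 mul0r.
Qed.

Lemma bounded_add a b : bounded_operator (fun x => a x + b x).
Proof.
apply/bounded_operatorP; split.
  by move=> k x y; rewrite !linearP /= scalerDr addrACA.
have [M M0 hM] := bop_bound a; have [N N0 hN] := bop_bound b.
exists (M + N); first exact: addr_ge0.
by move=> x; rewrite mulrDl; apply: le_trans (rnormD _ _) (lerD _ _).
Qed.

Lemma bounded_opp a : bounded_operator (fun x => - a x).
Proof.
apply/bounded_operatorP; split.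
  by move=> k x y; rewrite (linearP a) /= opprD scalerN.
by have [M M0 hM] := bop_bound a; exists M => // x; rewrite rnormN.
Qed.

Lemma bounded_id : bounded_operator (fun x : H => x).
Proof.
apply/bounded_operatorP; split=> //.
by exists 1 => // x; rewrite mul1r.
Qed.

Lemma bounded_comp a b : bounded_operator (fun x => a (b x)).
Proof.
apply/bounded_operatorP; split.
  by move=> k x y; rewrite !linearP.
have [M M0 hM] := bop_bound a; have [N N0 hN] := bop_bound b.
exists (M * N); first exact: mulr_ge0.
move=> x; apply: le_trans (hM _) _; rewrite -mulrA ler_wpM2l //.
Qed.

Lemma bounded_scale (z : R[i]) a : bounded_operator (fun x => z *: a x).
Proof.
split.
  by move=> k x y; rewrite linearP scalerDr !scalerA mulrC.
have [_ [M hM]] := bopP a; exists (`|z| * M) => x.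
by rewrite normrZ -mulrA ler_wpM2l.
Qed.

Definition bzero : E := Bop hn bounded_zero.
Definition bone : E := Bop hn bounded_id.
Definition badd a b : E := Bop hn (bounded_add a b).
Definition bopp a : E := Bop hn (bounded_opp a).
Definition bmul a b : E := Bop hn (bounded_comp a b).
Definition bscale c a : E := Bop hn (bounded_scale c%:C a).

Lemma baddA : associative badd.
Proof. by move=> a b d; apply: bop_ext => x /=; rewrite addrA. Qed.
Lemma baddC : commutative badd.
Proof. by move=> a b; apply: bop_ext => x /=; rewrite addrC. Qed.
Lemma badd0 : left_id bzero badd.
Proof. by move=> a; apply: bop_ext => x /=; rewrite add0r. Qed.
Lemma baddN : left_inverse bzero bopp badd.
Proof. by move=> a; apply: bop_ext => x /=; rewrite addNr. Qed.
HB.instance Definition _ := GRing.isZmodule.Build E baddA baddC badd0 baddN.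

Lemma bmulA : associative bmul.
Proof. by move=> a b d; apply: bop_ext. Qed.
Lemma bmul1 : left_id bone bmul.
Proof. by move=> a; apply: bop_ext. Qed.
Lemma bmul1r : right_id bone bmul.
Proof. by move=> a; apply: bop_ext. Qed.
Lemma bmulDl : left_distributive bmul +%R.
Proof. by move=> a b d; apply: bop_ext. Qed.
Lemma bmulDr : right_distributive bmul +%R.
Proof. by move=> a b d; apply: bop_ext => x; rewrite /= linearD. Qed.
Lemma bone_neq0 : bone != 0.
Proof.
apply/eqP => e; case: hn => x /eqP; apply.
by have : bone x = (0 : E) x by rewrite e.
Qed.
HB.instance Definition _ := GRing.Zmodule_isNzRing.Build E
  bmulA bmul1 bmul1r bmulDl bmulDr bone_neq0.

Lemma bscaleA c d a : bscale c (bscale d a) = bscale (c * d) a.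
Proof. by apply: bop_ext => x /=; rewrite scalerA rmorphM. Qed.
Lemma bscale1 : left_id 1 bscale.
Proof. by move=> a; apply: bop_ext => x /=; rewrite scale1r. Qed.
Lemma bscaleDr : right_distributive bscale +%R.
Proof. by move=> c a b; apply: bop_ext => x /=; rewrite scalerDr. Qed.
Lemma bscaleDl a : {morph bscale^~ a : c d / c + d}.
Proof. by move=> c d; apply: bop_ext => x /=; rewrite rmorphD scalerDl. Qed.
HB.instance Definition _ := GRing.Zmodule_isLmodule.Build R E
  bscaleA bscale1 bscaleDr bscaleDl.

Lemma bscaleAl c a b : c *: (a * b) = (c *: a) * b.
Proof. by apply: bop_ext. Qed.
HB.instance Definition _ := GRing.Lmodule_isLalgebra.Build R E bscaleAl.
Lemma bscaleAr c a b : c *: (a * b) = a * (c *: b).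
Proof. by apply: bop_ext => x /=; rewrite linearZ. Qed.
HB.instance Definition _ := GRing.Lalgebra_isAlgebra.Build R E bscaleAr.

Definition binvertible : pred E := fun a => `[< exists b, b * a = 1 /\ a * b = 1 >].
Definition binv a : E :=
  if pselect (exists b, b * a = 1 /\ a * b = 1) is left h then projT1 (cid h) else a.

Lemma binvP a : a \in binvertible -> binv a * a = 1 /\ a * binv a = 1.
Proof.
move=> /asboolP h; rewrite /binv; case: pselect => // h'; by case: (cid h').
Qed.
Lemma bmulVr : {in binvertible, left_inverse 1 binv *%R}.
Proof. by move=> a /binvP[]. Qed.
Lemma bmulrV : {in binvertible, right_inverse 1 binv *%R}.
Proof. by move=> a /binvP[]. Qed.
Lemma bunitP a b : b * a = 1 /\ a * b = 1 -> binvertible a.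
Proof. by move=> h; apply/asboolP; exists b. Qed.
Lemma binv_out : {in [predC binvertible], binv =1 id}.
Proof.
move=> a; rewrite inE /= => /asboolPn h.
by rewrite /binv; case: pselect.
Qed.
HB.instance Definition _ := GRing.NzRing_hasMulInverse.Build E
  bmulVr bmulrV bunitP binv_out.

Lemma bopD a b x : (a + b) x = a x + b x. Proof. by []. Qed.
Lemma bopN a x : (- a) x = - a x. Proof. by []. Qed.
Lemma bopB a b x : (a - b) x = a x - b x. Proof. by []. Qed.
Lemma bopM a b x : (a * b) x = a (b x). Proof. by []. Qed.
Lemma bopZ c a x : (c *: a) x = c%:C *: a x. Proof. by []. Qed.
Lemma bop1 x : (1 : E) x = x. Proof. by []. Qed.
Lemma bop0 x : (0 : E) x = 0. Proof. by []. Qed.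

Lemma bop_sum (I : Type) (s : seq I) (P : pred I) (F : I -> E) x :
  (\sum_(i <- s | P i) F i) x = \sum_(i <- s | P i) F i x.
Proof. by elim/big_rec2: _ => // i y a _ <-. Qed.

Lemma bop_inj a b : bfun a = bfun b -> a = b.
Proof. by move=> e; apply: bop_ext => x; rewrite e. Qed.

Lemma invertible_unit a : invertible a <-> a \is a GRing.unit.
Proof.
split=> [[B [pB h1 h2]]|ua].
  apply/unitrP; exists (Bop hn pB); split; apply: bop_ext => x.
    by rewrite bopM -[LHS]/((B \o a) x) h2.
  by rewrite bopM -[LHS]/((a \o B) x) h1.
exists a^-1; split; first exact: bopP.
  by apply: funext => x /=; rewrite -bopM mulrV.
by apply: funext => x /=; rewrite -bopM mulVr.
Qed.

Lemma opinv_bop a : a \is a GRing.unit -> opinv a = a^-1 :> (H -> H).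
Proof.
move=> ua; rewrite /opinv; case: xgetP => [B _ [pB h1 h2]|h].
  apply: funext => x.
  have -> : B x = (B \o a) (a^-1 x) by rewrite /= -(bopM a) mulrV.
  by rewrite h2.
by case: (invertible_unit a) => _ /(_ ua) [B hB]; case: (h B hB).
Qed.

(** E is an algebra over R, as evaluation of real polynomials requires. Complex scalars enter
    through this ring morphism with central values, at which complex factorizations can be
    evaluated. *)
Definition bscalar (z : R[i]) : E := Bop hn (bounded_scale z 1).

Lemma bscalar_is_zmod : zmod_morphism bscalar.
Proof. by move=> z t; apply: bop_ext => x /=; rewrite scalerBl. Qed.
Lemma bscalar_is_mul : monoid_morphism bscalar.
Proof.
split; first by apply: bop_ext => x /=; rewrite scale1r.
by move=> z t; apply: bop_ext => x /=; rewrite scalerA.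
Qed.
HB.instance Definition _ := GRing.isZmodMorphism.Build R[i] E bscalar bscalar_is_zmod.
HB.instance Definition _ := GRing.isMonoidMorphism.Build R[i] E bscalar bscalar_is_mul.

Lemma bscalarR c : bscalar c%:C = c%:A. Proof. by apply: bop_ext. Qed.

Lemma bscalar_unit (z : R[i]) : z != 0 -> bscalar z \is a GRing.unit.
Proof.
move=> z0; apply/unitrP; exists (bscalar z^-1); split; apply: bop_ext => x /=.
  by rewrite scalerA mulVf ?scale1r.
by rewrite scalerA divff ?scale1r.
Qed.

Lemma bscalar_comm a : commr_rmorph bscalar a.
Proof. by move=> z; apply: bop_ext => x /=; rewrite linearZ. Qed.

End BoundedOperators.

(** * Limiting arguments and discriminants over the reals *)

Section RealFacts.
Context {R : realType}.
Implicit Types (a b c e q t : R).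

Lemma le_of_eps a b c : (forall e, 0 < e -> a <= b + e * c) -> a <= b.
Proof.
move=> h; rewrite leNgt; apply/negP => ltba.
have d0 : 0 < a - b by lra.
have c1 : 0 < `|c| + 1 by have := normr_ge0 c; lra.
pose e := (a - b) / (`|c| + 1) / 2.
have e0 : 0 < e by rewrite !divr_gt0.
have eE : e * (`|c| + 1) = (a - b) / 2 by rewrite /e; field; rewrite gt_eqF.
have : e * c <= e * (`|c| + 1) by rewrite ler_wpM2l ?ltW //; have := ler_norm c; lra.
have := h e e0; rewrite eE; lra.
Qed.

Lemma discriminant_le a b c :
  0 <= c -> (forall t, 0 <= a + 2 * t * b + t ^+ 2 * c) -> b ^+ 2 <= a * c.
Proof.
move=> c0 h; have [c_eq0|c_neq0] := eqVneq c 0.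
  have := h 0; have [-> _|b0 _] := eqVneq b 0; first by rewrite c_eq0; lra.
  (* For c = 0 the form is affine in t, and at this t it takes the value -1. *)
  have := h (- (a + 1) / (2 * b)); rewrite c_eq0.
  have -> : a + 2 * (- (a + 1) / (2 * b)) * b + (- (a + 1) / (2 * b)) ^+ 2 * 0 = -1.
    by field.
  lra.
have cp : 0 < c by rewrite lt_def c_neq0.
have := h (- b / c).
have -> : a + 2 * (- b / c) * b + (- b / c) ^+ 2 * c = (a * c - b ^+ 2) / c by field.
by rewrite pmulr_lge0 ?invr_gt0 // subr_ge0.
Qed.

Lemma expr_small q e : 0 <= q -> q < 1 -> 0 < e ->
  exists N, forall n, (N <= n)%N -> q ^+ n <= e.
Proof.
move=> q0 q1 e0; have : `|q| < 1 by rewrite ger0_norm.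
move=> /cvg_expr /cvgrPdist_le /(_ e e0) [N _ hN].
exists N => n hn; have := hN n hn.
by rewrite sub0r normrN ger0_norm ?exprn_ge0.
Qed.

End RealFacts.

(** * The operator order *)

Section OperatorOrder.
Context {R : realType} {H : completeNormedModType R[i]}.
Context (hn : exists x : H, x != 0).
Context (ip : {dot H for Num.conj}) (hip : norm_of_inner_product ip).
Local Notation E := (bop hn).
Implicit Types (a b c d : E) (e r s t : R) (x y z : H).

(* On complex-linear maps, self-adjointness for [ip] and for its real part
   coincide, and so do the two notions of positivity. *)
Definition dot x y : R := complex.Re (ip x y).

Lemma dotC x y : dot x y = dot y x.
Proof.
rewrite /dot hermC expr0 mul1r.
have ReC (z : R[i]) : complex.Re (Num.conj z) = complex.Re z by case: z.
exact: ReC.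
Qed.

Lemma dotDl x y z : dot (x + y) z = dot x z + dot y z.
Proof. by rewrite /dot linearDl; rewrite raddfD. Qed.

Lemma dotDr x y z : dot x (y + z) = dot x y + dot x z.
Proof. by rewrite dotC dotDl !(dotC x). Qed.

Lemma dotZl r x y : dot (r%:C *: x) y = r * dot x y.
Proof.
rewrite /dot linearZl_LR /=; case: (ip x y) => p q; simpc => //=.
Qed.

Lemma dotZr r x y : dot x (r%:C *: y) = r * dot x y.
Proof. by rewrite dotC dotZl dotC. Qed.

Lemma dot0l x : dot 0 x = 0.
Proof. by rewrite -[0](scale0r 0) -(rmorph0 (real_complex R)) dotZl mul0r. Qed.

Lemma dot0r x : dot x 0 = 0.
Proof. by rewrite dotC dot0l. Qed.

Lemma dotNl x y : dot (- x) y = - dot x y.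
Proof. by rewrite -scaleN1r -[-1](rmorphN1 (real_complex R)) dotZl mulN1r. Qed.

Lemma dotNr x y : dot x (- y) = - dot x y.
Proof. by rewrite dotC dotNl dotC. Qed.

Lemma dotBl x y z : dot (x - y) z = dot x z - dot y z.
Proof. by rewrite dotDl dotNl. Qed.

Lemma dotBr x y z : dot x (y - z) = dot x y - dot x z.
Proof. by rewrite dotDr dotNr. Qed.

Lemma dotxx x : dot x x = rnorm x ^+ 2.
Proof. by rewrite /dot hip rnormE -rmorphXn. Qed.

Lemma dotxx_ge0 x : 0 <= dot x x.
Proof. by rewrite dotxx sqr_ge0. Qed.

Lemma dot_eq0 x : dot x x = 0 -> x = 0.
Proof.
by rewrite dotxx => /eqP; rewrite sqrf_eq0 => /eqP /rnorm0_eq0.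
Qed.

Definition selfadj a := forall x y, dot (a x) y = dot x (a y).
Definition pos a := selfadj a /\ forall x, 0 <= dot (a x) x.
Definition ople a b := pos (b - a).
Local Notation "a ⊑ b" := (ople a b) (at level 70).

Lemma selfadj0 : selfadj 0.
Proof. by move=> x y; rewrite !bop0 dot0l dot0r. Qed.
Lemma selfadj1 : selfadj 1. Proof. by []. Qed.
Lemma selfadjD a b : selfadj a -> selfadj b -> selfadj (a + b).
Proof. by move=> ha hb x y; rewrite !bopD dotDl dotDr ha hb. Qed.
Lemma selfadjN a : selfadj a -> selfadj (- a).
Proof. by move=> ha x y; rewrite !bopN dotNl dotNr ha. Qed.
Lemma selfadjB a b : selfadj a -> selfadj b -> selfadj (a - b).
Proof. by move=> ha hb; apply: selfadjD => //; apply: selfadjN. Qed.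
Lemma selfadjZ r a : selfadj a -> selfadj (r *: a).
Proof. by move=> ha x y; rewrite !bopZ dotZl dotZr ha. Qed.
Lemma selfadj_scalar r : selfadj r%:A.
Proof. exact: selfadjZ selfadj1. Qed.
Lemma selfadjM a b : selfadj a -> selfadj b -> a * b = b * a -> selfadj (a * b).
Proof. by move=> ha hb e x y; rewrite {2}e !bopM ha hb. Qed.
Lemma selfadj_conj a c : selfadj c -> selfadj a -> selfadj (c * a * c).
Proof. by move=> hc ha x y; rewrite !bopM hc ha hc. Qed.
Lemma selfadjX a n : selfadj a -> selfadj (a ^+ n).
Proof.
move=> ha; elim: n => [|n ih]; first exact: selfadj1.
by rewrite exprS; apply: selfadjM => //; rewrite -exprS -exprSr.
Qed.
Lemma selfadjV a : selfadj a -> selfadj a^-1.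
Proof.
have [ua|nua] := boolP (a \is a GRing.unit); last by rewrite invr_out.
move=> ha x y; have {1}-> : y = a (a^-1 y) by rewrite -bopM mulrV.
by rewrite -ha -bopM mulrV.
Qed.
Lemma selfadj_poly a (p : {poly R}) : selfadj a -> selfadj (horner_alg a p).
Proof.
move=> ha; elim/poly_ind: p => [|p k ih]; first by rewrite rmorph0; exact: selfadj0.
rewrite rmorphD rmorphM /= horner_algX horner_algC; apply: selfadjD (selfadj_scalar _).
apply: selfadjM => //.
by have := congr1 (horner_alg a) (mulrC p 'X); rewrite !rmorphM /= horner_algX.
Qed.

Lemma pos_selfadj a : pos a -> selfadj a. Proof. by case. Qed.
Lemma pos0 : pos 0.
Proof. by split=> [|x]; [exact: selfadj0 | rewrite dot0l]. Qed.
Lemma pos1 : pos 1.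
Proof. by split=> // x; exact: dotxx_ge0. Qed.
Lemma posD a b : pos a -> pos b -> pos (a + b).
Proof.
move=> [ha pa] [hb pb]; split; first exact: selfadjD.
by move=> x; rewrite bopD dotDl addr_ge0.
Qed.
Lemma posZ r a : 0 <= r -> pos a -> pos (r *: a).
Proof.
move=> r0 [ha pa]; split; first exact: selfadjZ.
by move=> x; rewrite bopZ dotZl mulr_ge0.
Qed.
Lemma pos_conj a c : selfadj c -> pos a -> pos (c * a * c).
Proof.
move=> hc [ha pa]; split; first exact: selfadj_conj.
by move=> x; rewrite !bopM hc.
Qed.
Lemma pos_sq c : selfadj c -> pos (c * c).
Proof. by move=> hc; rewrite -{1}[c]mulr1; apply: pos_conj hc pos1. Qed.

Lemma pos_cauchy_schwarz a x y : pos a ->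
  dot (a x) y ^+ 2 <= dot (a x) x * dot (a y) y.
Proof.
move=> [ha pa]; apply: discriminant_le => // t.
have := pa (x + t%:C *: y); rewrite linearD linearZ /= !dotDl !dotDr !dotZl !dotZr.
have -> : dot (a y) x = dot (a x) y by rewrite ha dotC.
by congr (0 <= _); ring.
Qed.

Lemma cauchy_schwarz x y : dot x y <= rnorm x * rnorm y.
Proof.
have := @pos_cauchy_schwarz 1 x y pos1; rewrite !bop1 !dotxx -exprMn => h.
apply: (le_trans (ler_norm _)).
rewrite -(ler_pXn2r (ltn0Sn 1)) ?nnegrE ?mulr_ge0 ?rnorm_ge0 //.
by rewrite real_normK ?num_real.
Qed.

Lemma ople_refl a : a ⊑ a.
Proof. by rewrite /ople subrr; exact: pos0. Qed.
Lemma ople_trans b a c : a ⊑ b -> b ⊑ c -> a ⊑ c.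
Proof.
by rewrite /ople => h1 h2; rewrite -(subrK b c) -addrA; exact: posD.
Qed.
(** The form of b - a is positive and vanishes on the diagonal, so the Cauchy-Schwarz inequality
    makes (b - a) x orthogonal to itself. *)
Lemma ople_anti a b : a ⊑ b -> b ⊑ a -> a = b.
Proof.
move=> h1 [_ h2]; apply/eqP; rewrite eq_sym -subr_eq0; apply/eqP.
apply: bop_ext => x; apply: dot_eq0.
have := pos_cauchy_schwarz x ((b - a) x) h1.
have -> : dot ((b - a) x) x = 0.
  apply/eqP; rewrite eq_le h1.2 andbT.
  by have := h2 x; rewrite -opprB bopN dotNl oppr_ge0.
rewrite mul0r => h; apply/eqP; rewrite -sqrf_eq0 eq_le h sqr_ge0 //.
Qed.
Lemma opleD a b c d : a ⊑ b -> c ⊑ d -> a + c ⊑ b + d.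
Proof. by move=> h1 h2; rewrite /ople opprD addrACA; exact: posD. Qed.
Lemma ople_sum (I : Type) (s : seq I) (F G : I -> E) :
  (forall i, F i ⊑ G i) -> \sum_(i <- s) F i ⊑ \sum_(i <- s) G i.
Proof.
move=> h; elim/big_rec2: _ => [|i a b _ ha]; first exact: ople_refl.
exact: opleD.
Qed.
Lemma opleN a b : a ⊑ b -> - b ⊑ - a.
Proof. by rewrite /ople opprK addrC. Qed.
Lemma opleZ r a b : 0 <= r -> a ⊑ b -> r *: a ⊑ r *: b.
Proof. by move=> r0 h; rewrite /ople -scalerBr; exact: posZ. Qed.
Lemma ople_conj c a b : selfadj c -> a ⊑ b -> c * a * c ⊑ c * b * c.
Proof. by move=> hc h; rewrite /ople -mulrBl -mulrBr; exact: pos_conj. Qed.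
Lemma ople0 a : (0 ⊑ a) = pos a.
Proof. by rewrite /ople subr0. Qed.
Lemma opleZr r s a : pos a -> r <= s -> r *: a ⊑ s *: a.
Proof. by move=> pa rs; rewrite /ople -scalerBl; apply: posZ; rewrite ?subr_ge0. Qed.
Lemma ople_scalar r s : r <= s -> r%:A ⊑ (s%:A : E).
Proof. exact: opleZr pos1. Qed.
Lemma ople_dot a b x : a ⊑ b -> dot (a x) x <= dot (b x) x.
Proof. by move=> [_ /(_ x)]; rewrite bopB dotBl subr_ge0. Qed.
Lemma ople_dotP a b : selfadj a -> selfadj b ->
  (forall x, dot (a x) x <= dot (b x) x) -> a ⊑ b.
Proof.
move=> ha hb h; split; first exact: selfadjB.
by move=> x; rewrite bopB dotBl subr_ge0.
Qed.
Lemma ople_posr a b : pos a -> a ⊑ b -> pos b.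
Proof. by rewrite -!ople0 => h1 h2; apply: ople_trans h2. Qed.

(** Over the complex numbers a real quadratic form forces self-adjointness: [dot (a z) ('i *: z)] is
    the imaginary part of the form, and expanding it at z = x + i y leaves the difference of
    [dot (a y) x] and [dot (a x) y]. *)
Lemma positive_operatorP a : positive_operator ip a <-> pos a.
Proof.
have ImE x y : complex.Im (ip x y) = dot x ('i *: y).
  by rewrite /dot linearZr_LR /=; case: (ip x y) => p q; simpc.
have dotii x y : dot ('i *: x) ('i *: y) = dot x y.
  rewrite /dot linearZr_LR linearZl_LR /=; case: (ip x y) => p q; simpc => //=.
split=> [h|[h1 h2] x]; last first.
  have e : dot (a x) ('i *: x) = 0.
    have : dot (a x) ('i *: x) = - dot (a x) ('i *: x); last lra.
    rewrite {1}h1 linearZ /= -[in RHS]dotii scalerA -expr2 sqr_i scaleN1r.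
    by rewrite dotNr opprK dotC.
  by rewrite lecE ImE e eqxx /=; exact: h2.
have him x : dot (a x) ('i *: x) = 0 by rewrite -ImE ger0_Im.
split; last by move=> x; have := h x; rewrite lecE => /andP[].
move=> x y; have := him (x + 'i *: y).
rewrite linearD linearZ /= scalerDr scalerA -expr2 sqr_i scaleN1r.
have e : dot ('i *: a y) y = 0.
  by rewrite -dotii scalerA -expr2 sqr_i scaleN1r dotNl him oppr0.
rewrite dotDl !dotDr !dotNr dotii him e (dotC (a y)); lra.
Qed.

Lemma op_leP a b : op_le ip a b <-> a ⊑ b.
Proof. exact: (positive_operatorP (b - a)). Qed.

End OperatorOrder.

(** * Spectrum and positivity *)

Section Spectrum.
Context {R : realType} {H : completeNormedModType R[i]}.
Context (hn : exists x : H, x != 0).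
Context (ip : {dot H for Num.conj}) (hip : norm_of_inner_product ip).
Local Notation E := (bop hn).
Local Notation "a ⊑ b" := (ople ip a b) (at level 70).
Local Notation dot := (dot ip).
Implicit Types (a b c d : E) (e r s t M : R) (x y z : H).

(** An upper bound on the operator norm as a predicate, so that sums, products and limits are
    estimated vector by vector, without a supremum. *)
Definition bnd a M := forall x, rnorm (a x) <= M * rnorm x.

Lemma bnd_weak a M N : M <= N -> bnd a M -> bnd a N.
Proof. by move=> MN h x; apply: le_trans (h x) _; rewrite ler_wpM2r ?rnorm_ge0. Qed.
Lemma bndD a b M N : bnd a M -> bnd b N -> bnd (a + b) (M + N).
Proof. by move=> ha hb x; rewrite mulrDl; apply: le_trans (rnormD _ _) (lerD _ _). Qed.
Lemma bndN a M : bnd a M -> bnd (- a) M.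
Proof. by move=> ha x; rewrite bopN rnormN. Qed.
Lemma bndB a b M N : bnd a M -> bnd b N -> bnd (a - b) (M + N).
Proof. by move=> ha hb; apply: bndD => //; apply: bndN. Qed.
Lemma bndBC a b M : bnd (a - b) M -> bnd (b - a) M.
Proof. by move=> /bndN; rewrite opprB. Qed.
Lemma bndM a b M N : 0 <= M -> bnd a M -> bnd b N -> bnd (a * b) (M * N).
Proof.
move=> M0 ha hb x; apply: le_trans (ha _) _.
by rewrite -mulrA ler_wpM2l.
Qed.
Lemma bnd1 : bnd 1 1. Proof. by move=> x; rewrite mul1r. Qed.
Lemma bndX a M n : 0 <= M -> bnd a M -> bnd (a ^+ n) (M ^+ n).
Proof.
move=> M0 ha; elim: n => [|n ih]; first exact: bnd1.
by rewrite !exprS; apply: bndM.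
Qed.

Lemma bnd_eps_eq0 a M : (forall e, 0 < e -> bnd a (e * M)) -> a = 0.
Proof.
move=> h; apply: bop_ext => x; apply: rnorm0_eq0; apply/eqP.
rewrite eq_le rnorm_ge0 andbT; apply: (@le_of_eps _ _ _ (M * rnorm x)) => e e0.
by rewrite add0r mulrA; exact: h.
Qed.

Lemma ople_bnd a M : selfadj ip a -> bnd a M -> a ⊑ M%:A.
Proof.
move=> ha h; apply: ople_dotP => //; first exact: selfadj_scalar.
move=> x; rewrite bopZ bop1 dotZl (dotxx hip) expr2 mulrA.
apply: le_trans (cauchy_schwarz hn hip _ _) _.
by rewrite ler_wpM2r ?rnorm_ge0.
Qed.

Lemma selfadj_bound a : selfadj ip a -> exists2 M, 0 < M & (- M)%:A ⊑ a /\ a ⊑ M%:A.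
Proof.
move=> ha; have [M M0 hM] := bop_bound a.
have hM1 : bnd a (M + 1) by apply: bnd_weak hM; lra.
exists (M + 1); first lra.
split; last exact: ople_bnd.
rewrite -[a]opprK scaleNr; apply: opleN; apply: ople_bnd; first exact: selfadjN.
exact: bndN.
Qed.

Lemma bnd_ople a e : 0 < e -> selfadj ip a -> (- e)%:A ⊑ a -> a ⊑ e%:A -> bnd a e.
Proof.
move=> e0 ha h1 h2.
pose u := e%:A + a; pose v := e%:A - a.
have pu : pos ip u by move: h1; rewrite /ople scaleNr opprK addrC.
have pv : pos ip v by [].
have hu := pos_selfadj pu; have hv := pos_selfadj pv.
have : pos ip (u * v * u + v * u * v) by apply: (posD (pos_conj _ _) (pos_conj _ _)).
have -> : u * v * u + v * u * v = (2 * e) *: ((e ^+ 2)%:A - a * a).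
  have uE : u = horner_alg a (e%:P + 'X) by rewrite rmorphD /= horner_algC horner_algX.
  have vE : v = horner_alg a (e%:P - 'X) by rewrite rmorphB /= horner_algC horner_algX.
  have hE k l : k *: (l%:A - a * a) = horner_alg a (k%:P * (l%:P - 'X * 'X)).
    by rewrite !(rmorphM, rmorphB) /= !horner_algC horner_algX mulr_algl.
  (* With u = e + a and v = e - a: u v u + v u v = 2 e (e^2 - a^2). *)
  rewrite hE.
  rewrite uE vE -!rmorphM -rmorphD; congr horner_alg.
  rewrite polyCM polyC_exp; ring.
move=> pe x.
have := (posZ (hn := hn) (r := (2 * e)^-1) _ pe).
rewrite scalerA mulVf ?scale1r; last by rewrite gt_eqF //; lra.
case; first by rewrite invr_ge0; lra.
move=> _ /(_ x); rewrite bopB bopZ bop1 dotBl dotZl bopM ha !(dotxx hip) subr_ge0.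
by rewrite -exprMn ler_pXn2r // ?nnegrE ?rnorm_ge0 ?mulr_ge0 ?rnorm_ge0 ?ltW.
Qed.

Lemma bop_complete (u : nat -> E) :
  (forall e, 0 < e -> exists N, forall m n, (N <= m)%N -> (N <= n)%N ->
     bnd (u m - u n) e) ->
  exists b : E, forall e, 0 < e -> exists N, forall n, (N <= n)%N -> bnd (u n - b) e.
Proof.
move=> hu.
have hx x : exists l, forall e, 0 < e -> exists N, forall n, (N <= n)%N ->
    rnorm (u n x - l) <= e.
  apply: rnorm_complete => e e0.
  have nx : 0 < rnorm x + 1 by have := rnorm_ge0 x; lra.
  have [N hN] := hu (e / (rnorm x + 1)) (divr_gt0 e0 nx).
  exists N => m n hm hn'; apply: le_trans (hN m n hm hn' x) _.
  by rewrite -mulrA ger_pMr // mulrC ler_pdivrMr //; lra.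
have [l hl] := choice hx.
have uniq x y : (forall e, 0 < e ->
    exists n, rnorm (u n x - y) <= e /\ rnorm (u n x - l x) <= e) -> y = l x.
  move=> h; apply/eqP; rewrite -subr_eq0; apply/eqP/rnorm0_eq0/eqP.
  rewrite eq_le rnorm_ge0 andbT; apply: (@le_of_eps _ _ _ 2) => e e0.
  have [n [h1 h2]] := h e e0; rewrite add0r.
  have -> : y - l x = - (u n x - y) + (u n x - l x) by rewrite opprB addrA subrK.
  by have := rnormD (- (u n x - y)) (u n x - l x); rewrite rnormN; lra.
have lin : linear l.
  move=> k x y; symmetry; apply: uniq => e e0.
  pose K := complex.Re `|k| + 1.
  have K0 : 0 <= complex.Re `|k| by rewrite -ler0c RRe_real // ger0_real.
  have nrk z : rnorm (k *: z) = complex.Re `|k| * rnorm z.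
    apply: complexI; rewrite -rnormE normrZ rnormE rmorphM /= RRe_real // ger0_real //.
  have d0 : 0 < e / (K + 1) by rewrite divr_gt0 // /K; lra.
  have [N1 h1] := hl x _ d0; have [N2 h2] := hl y _ d0; have [N3 h3] := hl (k *: x + y) _ e0.
  exists (N1 + N2 + N3)%N; split; last by apply: h3; rewrite leq_addl.
  set n := (_ + _)%N; rewrite linearP /=.
  have -> : k *: u n x + u n y - (k *: l x + l y) = k *: (u n x - l x) + (u n y - l y).
    by rewrite scalerBr addrACA opprD.
  apply: le_trans (rnormD _ _) _; rewrite nrk.
  have := h1 n; rewrite {1}/n -addnA leq_addr => /(_ isT) h1'.
  have := h2 n; rewrite {1}/n addnAC leq_addl => /(_ isT) h2'.
  have eE : e = e / (K + 1) * (K + 1) by rewrite divfK // gt_eqF // /K; lra.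
  have : complex.Re `|k| * rnorm (u n x - l x) <= complex.Re `|k| * (e / (K + 1)).
    exact: ler_wpM2l.
  rewrite [X in _ -> _ <= X]eE /K; set w := e / _; rewrite -/w in h2' d0 *; nra.
(* From N on, all [u n] stay within 1 of [u N], so a bound M for [u N] gives the bound M + 1 for the
   limit. *)
have [N hN] := hu 1 ltr01.
have [M M0 hM] := bop_bound (u N).
have bl : bounded_operator l.
  apply/bounded_operatorP; split=> //; exists (M + 1); first lra.
  move=> x; apply: (@le_of_eps _ _ _ 1) => e e0.
  have [N' h'] := hl x e e0.
  have := h' (N + N')%N (leq_addl _ _); set n := (_ + _)%N => hn'.
  have h1 := hN n N (leq_addr _ _) (leqnn _) x.
  have -> : l x = - (u n x - l x) + (u n - u N) x + u N x.
    by rewrite bopB -addrA subrK opprB subrK.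
  apply: le_trans (rnormD _ _) _; apply: le_trans (lerD (rnormD _ _) (hM x)) _.
  by rewrite rnormN; move: h1 hn'; lra.
exists (Bop hn bl) => e e0.
have [N0 hN0] := hu e e0; exists N0 => n hn' x /=.
apply: (@le_of_eps _ _ _ 1) => e' e'0.
have [N1 hN1] := hl x e' e'0.
have h1 := hN1 (N0 + N1)%N (leq_addl _ _).
have h2 := hN0 n (N0 + N1)%N hn' (leq_addr _ _) x.
rewrite -[u n x](subrK (u (N0 + N1)%N x)) -addrA.
by apply: le_trans (rnormD _ _) _; rewrite mulr1; apply: lerD.
Qed.

(** Neumann series: the partial sums u of the powers of k = 1 - a satisfy a u = u a = 1 - k^n, and
    their limit is the inverse. *)
Lemma neumann_unit a q : 0 <= q -> q < 1 -> bnd (1 - a) q -> a \is a GRing.unit.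
Proof.
move=> q0 q1 hq; pose k := 1 - a.
pose u n := \sum_(i < n) k ^+ i.
have ku n : k * u n = u n * k.
  by rewrite /u mulr_sumr mulr_suml; apply: eq_bigr => i _; rewrite -exprS exprSr.
have au n : a * u n = 1 - k ^+ n.
  have -> : a = 1 - k by rewrite /k opprB addrC subrK.
  by rewrite /u -[LHS]opprK -mulNr opprB -subrX1 opprB.
have ua n : u n * a = 1 - k ^+ n.
  by rewrite -au -[a](subKr 1) -/k mulrBl mulrBr mulr1 mul1r ku.
have ub n : bnd (u n) (1 - q)^-1.
  have : bnd (u n) (\sum_(i < n) q ^+ i).
    rewrite /u; elim: n => [|n ih].
      by move=> x; rewrite !big_ord0 bop0 rnorm0 mul0r.
    by rewrite !big_ord_recr /=; apply: bndD => //; apply: bndX.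
  apply: bnd_weak; rewrite -[_^-1]mul1r ler_pdivlMr; last lra.
  have := subrX1 q n; have := exprn_ge0 n q0; lra.
have usplit n m : u (n + m)%N - u n = k ^+ n * u m.
  rewrite /u big_split_ord /= addrAC subrr add0r mulr_sumr.
  by apply: eq_bigr => i _; rewrite exprD.
have [b hb] : exists b : E, forall e, 0 < e -> exists N, forall n, (N <= n)%N -> bnd (u n - b) e.
  apply: bop_complete => e e0.
  have q1' : 0 < 1 - q by lra.
  have [N hN] := expr_small q0 q1 (mulr_gt0 e0 q1').
  exists N => m n.
  wlog lmn : m n / (n <= m)%N => [hw hm hn'|hm hn'].
    case/orP: (leq_total n m) => l; first exact: hw.
    by apply: bndBC; apply: hw.
  rewrite -(subnKC lmn) usplit; apply: bnd_weak (bndM _ (bndX _ q0 hq) (ub _)).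
    by rewrite ler_pdivrMr; [exact: hN|lra].
  exact: exprn_ge0.
have [Ma Ma0 hMa] := bop_bound a.
have small e : 0 < e -> exists n, bnd (u n - b) e /\ bnd (k ^+ n) e.
  move=> e0; have [N hN] := hb e e0.
  have [N' hN'] := expr_small q0 q1 e0.
  exists (N + N')%N; split; first by apply: hN; rewrite leq_addr.
  by apply: bnd_weak (bndX _ q0 hq); apply: hN'; rewrite leq_addl.
apply/unitrP; exists b; split; apply/eqP; rewrite -subr_eq0; apply/eqP;
  apply: (@bnd_eps_eq0 _ (Ma + 1)) => e e0; have [n [h1 h2]] := small e e0.
  have -> : b * a - 1 = - ((u n - b) * a) - k ^+ n.
    by rewrite mulrBl ua !opprB addrA addrAC addrK.
  rewrite mulrDr mulr1; apply: bndB => //; apply: bndN.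
  by apply: bndM => //; exact: ltW.
have -> : a * b - 1 = - (a * (u n - b)) - k ^+ n.
  by rewrite mulrBr au !opprB addrA addrAC addrK.
rewrite [e * _]mulrDr mulr1 [e * Ma]mulrC; apply: bndB => //; apply: bndN.
exact: bndM.
Qed.

End Spectrum.

(** * Invertibility from lower bounds, and positivity of polynomials on the spectrum *)

Section SpectralOrder.
Context {R : realType} {H : completeNormedModType R[i]}.
Context (hn : exists x : H, x != 0).
Context (ip : {dot H for Num.conj}) (hip : norm_of_inner_product ip).
Local Notation E := (bop hn).
Local Notation "a ⊑ b" := (ople ip a b) (at level 70).
Local Notation dot := (dot ip).
Implicit Types (a b c d : E) (e m r s t M : R) (x y z : H) (p q : {poly R}).

(** As in the Lax-Milgram theorem: if K bounds a, the squared norm of x - t a x is at most (1 - 2 t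
    m + t^2 K^2) times that of x, so 1 - t a is a strict contraction for a suitable t and the
    Neumann series inverts t a. *)
Lemma coercive_unit a m : 0 < m ->
  (forall x, m * rnorm x ^+ 2 <= dot (a x) x) -> a \is a GRing.unit.
Proof.
move=> m0 hm; have [K0 K00 hK0] := bop_bound a.
pose K := K0 + m; have Kp : 0 < K by rewrite /K; lra.
have hK : bnd a K by apply: bnd_weak hK0; rewrite /K; lra.
(* This t minimises 1 - 2 t m + t^2 K^2, with minimum 1 - d for the d below. Adding m to [K0]
   ensures m <= K, hence d <= 1. *)
pose t := m / K ^+ 2.
have t0 : 0 < t by rewrite divr_gt0 // exprn_gt0.
have ut : t \is a GRing.unit by rewrite unitfE gt_eqF.
rewrite -(scaler_unit _ ut).
pose d := m ^+ 2 / K ^+ 2.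
have d0 : 0 < d by rewrite divr_gt0 // exprn_gt0.
have d1 : d <= 1.
  have mK : m <= K by rewrite /K; lra.
  by rewrite ler_pdivrMr ?exprn_gt0 // mul1r ler_pXn2r ?nnegrE // ltW.
apply: (@neumann_unit _ _ _ _ (Num.sqrt (1 - d))); first exact: sqrtr_ge0.
  by rewrite -[X in _ < X]sqrtr1 ltr_sqrt //; lra.
move=> x.
rewrite -(ler_pXn2r (ltn0Sn 1)) ?nnegrE ?mulr_ge0 ?rnorm_ge0 ?sqrtr_ge0 //.
rewrite exprMn sqr_sqrtr; last lra.
rewrite -(dotxx hip) bopB bop1 bopZ dotBl !dotBr dotZl !dotZr !dotZl !(dotxx hip).
rewrite (dotC ip x).
have h1 := hm x.
have h2 : rnorm (a x) ^+ 2 <= K ^+ 2 * rnorm x ^+ 2.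
  by rewrite -exprMn ler_pXn2r // ?nnegrE ?mulr_ge0 ?rnorm_ge0 // ltW.
have e1 : t * m = d by rewrite /t /d; field; rewrite gt_eqF.
have e2 : t * (t * K ^+ 2) = d by rewrite /t /d; field; rewrite gt_eqF.
have h3 : t * (m * rnorm x ^+ 2) <= t * dot (a x) x by rewrite ler_wpM2l // ltW.
have h4 : t * (t * rnorm (a x) ^+ 2) <= t * (t * (K ^+ 2 * rnorm x ^+ 2)).
  by rewrite !ler_wpM2l // ltW.
have e3 : t * (t * (K ^+ 2 * rnorm x ^+ 2)) = d * rnorm x ^+ 2 by rewrite -e2; ring.
have e4 : t * (m * rnorm x ^+ 2) = d * rnorm x ^+ 2 by rewrite -e1; ring.
lra.
Qed.

Lemma ople_unit a m : 0 < m -> m%:A ⊑ a -> a \is a GRing.unit.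
Proof.
move=> m0 h; apply: (coercive_unit m0) => x.
by have := ople_dot x h; rewrite bopZ bop1 dotZl (dotxx hip).
Qed.

(** If M bounds the inverse and a is at most K, then the norm of x is at most M times that of a x,
    whose square is at most K [dot (a x) x] by the Cauchy-Schwarz inequality for the form of a. The
    added 1 keeps the constant positive. *)
Lemma pos_unit_lower a : pos ip a -> a \is a GRing.unit ->
  exists2 m, 0 < m & m%:A ⊑ a.
Proof.
move=> pa ua; have [M M0 hM] := bop_bound a^-1.
have [K K0 [_ hK]] := selfadj_bound hip (pos_selfadj pa).
have L0 : 0 < M ^+ 2 * K + 1 by have := mulr_ge0 (sqr_ge0 M) (ltW K0); lra.
exists (M ^+ 2 * K + 1)^-1; first by rewrite invr_gt0.
apply: ople_dotP; [exact: selfadj_scalar|exact: pos_selfadj|move=> x].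
rewrite bopZ bop1 dotZl (dotxx hip) mulrC ler_pdivrMr //.
have hx : rnorm x <= M * rnorm (a x) by have := hM (a x); rewrite -bopM mulVr.
have cs := pos_cauchy_schwarz x (a x) pa.
have hax := ople_dot (a x) hK; rewrite bopZ bop1 dotZl (dotxx hip) in hax.
have dx : 0 <= dot (a x) x by case: pa.
rewrite (dotxx hip) in cs.
have h1 : rnorm (a x) ^+ 2 <= dot (a x) x * K.
  have [e0|en] := eqVneq (rnorm (a x)) 0; first by rewrite e0 expr0n mulr_ge0 // ltW.
  have sp : 0 < rnorm (a x) ^+ 2 by rewrite exprn_gt0 // lt_def en rnorm_ge0.
  move: (rnorm (a x) ^+ 2) cs sp hax => s cs sp hax.
  by rewrite -(ler_pM2r sp) -mulrA -expr2; apply: (le_trans cs); rewrite ler_wpM2l.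
have h2 : rnorm x ^+ 2 <= M ^+ 2 * rnorm (a x) ^+ 2.
  by rewrite -exprMn ler_pXn2r // ?nnegrE ?mulr_ge0 ?rnorm_ge0.
have h3 : M ^+ 2 * rnorm (a x) ^+ 2 <= M ^+ 2 * (dot (a x) x * K) by rewrite ler_wpM2l ?sqr_ge0.
lra.
Qed.

Definition rspec a : set R := [set t | a - t%:A \isn't a GRing.unit].

Lemma spectrumE a (z : R[i]) :
  spectrum a z <-> a - bscalar hn z \isn't a GRing.unit.
Proof.
rewrite /spectrum /=; have := invertible_unit (a - bscalar hn z).
split=> [h|/negP h]; last first.
  by move=> /(invertible_unit (a - bscalar hn z)).
by apply/negP => u; apply: h; apply/(invertible_unit (a - bscalar hn z)).
Qed.

Lemma spectrum_rspec a t : spectrum a t%:C <-> rspec a t.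
Proof. by rewrite spectrumE bscalarR. Qed.

Lemma selfadj_spectrum_real a (z : R[i]) : selfadj ip a -> spectrum a z -> z = (complex.Re z)%:C.
Proof.
move=> ha /spectrumE nu; apply/eqP/negPn/negP => zr.
have q0 : complex.Im z != 0 by apply: contra zr; case: (z) => p q /= /eqP ->.
move/negP: nu; apply.
(* With z' the conjugate of z, (a - z) (a - z') = (a - Re z)^2 + (Im z)^2 is
   bounded below. *)
pose J := bscalar hn 'i; pose u := a - (complex.Re z)%:A; pose qJ := complex.Im z *: J.
have hu : selfadj ip u by apply: selfadjB => //; exact: selfadj_scalar.
have zE : a - bscalar hn z = u - qJ.
  rewrite [z in LHS]complexE rmorphD rmorphM /= !bscalarR opprD addrA mulr_algr.
  by [].
have cuJ : u * qJ = qJ * u.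
  by rewrite /qJ -scalerAr -scalerAl; congr (_ *: _); exact: bscalar_comm.
have gen (v w : E) : v * w = w * v -> (v - w) * (v + w) = v * v - w * w.
  by move=> vw; rewrite mulrBl !mulrDr vw opprD addrA addrK.
have gen' (v w : E) : v * w = w * v -> (v + w) * (v - w) = v * v - w * w.
  by move=> vw; rewrite mulrDl !mulrBr vw addrA subrK.
have e : (u - qJ) * (u + qJ) = u * u + (complex.Im z ^+ 2)%:A.
  rewrite gen //; congr (_ + _).
  rewrite /qJ -scalerAl -scalerAr scalerA -expr2 -rmorphM -expr2 sqr_i.
  by rewrite rmorphN rmorph1 scalerN opprK.
have : (u - qJ) * (u + qJ) \is a GRing.unit.
  rewrite e; apply: (@ople_unit _ (complex.Im z ^+ 2)).
    by rewrite exprn_even_gt0.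
  by rewrite /ople addrK; exact: pos_sq.
rewrite unitrM_comm ?zE; first by case/andP.
by rewrite /GRing.comm gen // gen'.
Qed.

Lemma rspec_lower a m t : m%:A ⊑ a -> rspec a t -> m <= t.
Proof.
move=> h; rewrite /rspec /= leNgt => /negP nu; apply/negP => tm; apply: nu.
apply: (@ople_unit _ (m - t)); first lra.
by rewrite scalerBl; apply: opleD (ople_refl _ _).
Qed.

Lemma rspec_upper a m t : a ⊑ m%:A -> rspec a t -> t <= m.
Proof.
move=> h; rewrite /rspec /= leNgt => /negP nu; apply/negP => tm; apply: nu.
rewrite -unitrN opprB; apply: (@ople_unit _ (t - m)); first lra.
by rewrite scalerBl; apply: opleD (ople_refl _ _) (opleN _).
Qed.

(** Take the largest scalar lower bound m. If a - m were invertible, being positive it would be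
    bounded below by some d > 0, and m + d would be a larger lower bound. *)
Lemma rspec_inf a : selfadj ip a -> exists2 m, rspec a m & m%:A ⊑ a.
Proof.
move=> ha; have [M M0 [lM uM]] := selfadj_bound hip ha.
pose S := [set m : R | m%:A ⊑ a]%classic.
have S0 : (S !=set0)%classic by exists (- M).
have [x0 x0n] := hn.
have xp : 0 < rnorm x0 ^+ 2.
  rewrite exprn_gt0 // lt_def rnorm_ge0 andbT; apply: contra x0n => /eqP /rnorm0_eq0 ->.
  by [].
have Sb : ubound S M.
  move=> m hm; have := ople_dot x0 (ople_trans hm uM).
  by rewrite !bopZ !bop1 !dotZl (dotxx hip) ler_pM2r.
have hS : has_sup S by split=> //; exists M.
have inS : (sup S)%:A ⊑ a.
  apply: ople_dotP => //; first exact: selfadj_scalar.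
  move=> x; rewrite bopZ bop1 dotZl (dotxx hip).
  apply: (@le_of_eps _ _ _ (rnorm x ^+ 2)) => e e0.
  have [m hm lt] := sup_adherent e0 hS.
  have := ople_dot x hm; rewrite bopZ bop1 dotZl (dotxx hip).
  have := sqr_ge0 (rnorm x); nra.
exists (sup S) => //; apply/negP => u.
have [d d0 hd] := pos_unit_lower inS u.
have : S (sup S + d).
  by have := opleD hd (ople_refl ip (sup S)%:A); rewrite subrK -scalerDl addrC.
move=> /(ub_le_sup (ex_intro _ M Sb)); lra.
Qed.

Lemma horner_morphE a p :
  horner_morph (bscalar_comm a) (map_poly (real_complex R) p) = horner_alg a p.
Proof.
elim/poly_ind: p => [|p k ih]; first by rewrite !rmorph0.
rewrite !rmorphD !rmorphM /= ih map_polyX map_polyC /= horner_morphX horner_morphC.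
rewrite horner_algX horner_algC; congr (_ + _); exact: bscalarR.
Qed.

Lemma rspec_poly a p m : selfadj ip a -> rspec (horner_alg a p) m ->
  exists2 t, rspec a t & p.[t] = m.
Proof.
move=> ha hm; pose q := map_poly (real_complex R) (p - m%:P).
have hq : horner_morph (bscalar_comm a) q = horner_alg a p - m%:A.
  by rewrite horner_morphE rmorphB /= horner_algC.
(* If p is the constant m, every spectral point is a witness, and [rspec_inf] provides one. *)
have [q0|qn0] := eqVneq q 0.
  have [t ht _] := rspec_inf ha; exists t => //.
  have : p - m%:P = 0 by apply/eqP; rewrite -(map_poly_eq0 (real_complex R)) -/q q0.
  by move/eqP; rewrite subr_eq0 => /eqP ->; rewrite hornerC.
have [rs qE] := closed_field_poly_normal q.
have [allu|] := boolP (all (fun z : R[i] => a - bscalar hn z \is a GRing.unit) rs).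
  case/negP: hm; rewrite -hq qE -mul_polyC rmorphM /= horner_morphC.
  rewrite rmorph_prod /=.
  rewrite unitrMr; last first.
    have l0 : lead_coef q != 0 by rewrite lead_coef_eq0.
    exact: bscalar_unit.
  elim: rs allu {qE} => [|z rs ih] /=; first by rewrite big_nil unitr1.
  move=> /andP[uz us]; rewrite big_cons unitrMr ?ih //.
  by rewrite rmorphB /= horner_morphX horner_morphC.
case/allPn => z zrs nu.
have zr : z = (complex.Re z)%:C by apply: selfadj_spectrum_real ha _; apply/spectrumE.
exists (complex.Re z); first by apply/spectrum_rspec; rewrite -zr; apply/spectrumE.
have : root q z by rewrite qE rootZ ?lead_coef_eq0 // root_prod_XsubC.
rewrite /root zr horner_map /= hornerD hornerN hornerC => /eqP /complexI /eqP.
by rewrite subr_eq0 => /eqP.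
Qed.

Lemma ople_poly a p q : selfadj ip a -> (forall t, rspec a t -> p.[t] <= q.[t]) ->
  horner_alg a p ⊑ horner_alg a q.
Proof.
move=> ha h; rewrite /ople -rmorphB /=.
have [m hm1 hm2] := rspec_inf (selfadj_poly (q - p) ha).
have [t ht e] := rspec_poly ha hm1.
rewrite -(ople0); apply: ople_trans hm2; rewrite -(scale0r (1 : E)).
by apply: ople_scalar => //; rewrite -e hornerD hornerN subr_ge0 h.
Qed.

End SpectralOrder.

(** * Functional calculus *)

Section UniformConvergence.
Context {R : realType}.
Implicit Types (e m t M : R) (p q : {poly R}) (f g : R -> R).

Lemma uniform_cvgP (D : set R) (u : nat -> R -> R) f :
  ({uniform D, u @ \oo --> f})%classic <->
  forall e, 0 < e -> exists N : nat, forall n, (N <= n)%N ->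
    forall t, D t -> `|u n t - f t| <= e.
Proof.
split=> [h e e0|h].
  have /h [N _ hN] : nbhs (f : {uniform` D -> R}) (fun g => forall t, D t -> `|g t - f t| <= e).
    apply/uniform_nbhs; exists (fun xy => ball xy.1 e xy.2); split.
      by rewrite -entourage_ballE; exists e.
    move=> g hg t Dt; have := hg t Dt.
    by rewrite /= -ball_normE /= distrC => /ltW.
  by exists N => n; exact: hN.
move=> P /uniform_nbhs [E [entE EP]].
move: entE; rewrite -entourage_ballE => -[e /= e0 eE].
have [N hN] := h (e / 2) (divr_gt0 e0 (ltr0Sn _ 1)).
exists N => // n hn; apply: EP => t Dt; apply: eE.
rewrite /= -ball_normE /= distrC; apply: le_lt_trans (hN n hn t Dt) _.
by move: (e0 : 0 < e); lra.
Qed.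

End UniformConvergence.

Section FunctionalCalculus.
Context {R : realType} {H : completeNormedModType R[i]}.
Context (hn : exists x : H, x != 0).
Context (ip : {dot H for Num.conj}) (hip : norm_of_inner_product ip).
Local Notation E := (bop hn).
Local Notation "a ⊑ b" := (ople ip a b) (at level 70).
Local Notation dot := (dot ip).
Implicit Types (a b c d : E) (e m r s t M : R) (x y z : H) (p q : {poly R}).
Implicit Types (f g : R -> R).

Lemma opnorm_has_sup a : has_sup [set complex.Re `|a x| | x in [set x : H | `|x| <= 1]]%classic.
Proof.
split; first by exists (complex.Re `|a 0|); exists 0 => //=; rewrite normr0.
have [M M0 hM] := bop_bound a; exists M => _ [x /= hx <-].
apply: le_trans (hM x) _; rewrite -[leRHS]mulr1.
by rewrite ler_wpM2l // -lecR -rnormE.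
Qed.

Lemma bnd_opnorm a : bnd a (opnorm a).
Proof.
move=> x; have [->|x0] := eqVneq x 0; first by rewrite linear0 rnorm0 mulr0.
have nx : 0 < rnorm x.
  by rewrite lt_def rnorm_ge0 andbT; apply: contra x0 => /eqP /rnorm0_eq0 ->.
rewrite -ler_pdivrMr //; apply: (ub_le_sup (opnorm_has_sup a).2).
exists ((rnorm x)^-1%:C *: x).
  rewrite /= rnormE rnormZ ger0_norm ?invr_ge0 ?rnorm_ge0 // mulVf ?gt_eqF //.
rewrite linearZ /= -[LHS]/(rnorm _) rnormZ ger0_norm ?invr_ge0 ?rnorm_ge0 //.
by rewrite mulrC.
Qed.

Lemma opnorm_le a M : 0 <= M -> bnd a M -> opnorm a <= M.
Proof.
move=> M0 h; apply: ge_sup; first exact: (opnorm_has_sup a).1.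
move=> _ [x /= hx <-]; apply: le_trans (h x) _.
by rewrite -[leRHS]mulr1 ler_wpM2l // -lecR -rnormE.
Qed.

Lemma opnorm_ge0 a : 0 <= opnorm a.
Proof.
apply: (ub_le_sup (opnorm_has_sup a).2).
by exists 0; rewrite /= ?linear0 ?normr0.
Qed.

(** The same relation as [is_functional_calculus], with one polynomial per tolerance in place of a
    sequence; sums, products and limits then need no choice of sequences. *)
Definition is_calc a f b := forall e, 0 < e -> exists p,
  (forall t, rspec a t -> `|p.[t] - f t| <= e) /\ bnd (horner_alg a p - b) e.

Lemma op_polyE a p : op_poly p a = horner_alg a p :> (H -> H).
Proof.
apply: funext => x; rewrite /op_poly.
have -> : horner_alg a p = \sum_(i < size p) p`_i *: a ^+ i.
  rewrite -{1}[p]coefK poly_def.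
  rewrite rmorph_sum /=; apply: eq_bigr => i _.
  by rewrite linearZ /= rmorphXn mulr_algl /= horner_algX.
rewrite bop_sum; apply: eq_bigr => i _; rewrite bopZ; congr (_ *: _).
elim: (nat_of_ord i) => [|n ih] //=; by rewrite ih exprS bopM.
Qed.

Lemma is_functional_calculusP a f b :
  is_functional_calculus a f b <-> is_calc a f b.
Proof.
have uE p : (fun x => op_poly p a x - b x) = (horner_alg a p - b : E) :> (H -> H).
  by apply: funext => x; rewrite op_polyE.
split=> [[_ [p [/uniform_cvgP h1 h2]]] e e0|h].
  have [N hN] := h1 e e0.
  move/cvgrPdist_le: h2 => /(_ e e0) [N' _ hN'].
  exists (p (N + N')%N); split.
    by move=> t /spectrum_rspec st; apply: hN => //; rewrite leq_addr.
  apply: bnd_weak (bnd_opnorm _).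
  have := hN' (N + N')%N (leq_addl _ _); rewrite /= sub0r normrN uE.
  by rewrite ger0_norm // opnorm_ge0.
split; first exact: bopP.
have hk k : exists p, (forall t, rspec a t -> `|p.[t] - f t| <= k.+1%:R^-1) /\
    bnd (horner_alg a p - b) k.+1%:R^-1.
  by apply: h; rewrite invr_gt0 ltr0Sn.
have [p hp] := choice hk; exists p; split.
  apply/uniform_cvgP => e e0; have [N hN] := natSinv_small e0.
  exists N => n Nn t /spectrum_rspec st.
  by apply: le_trans ((hp n).1 t st) (hN n Nn).
apply/cvgrPdist_le => e e0; have [N hN] := natSinv_small e0.
exists N => // n hn' /=; rewrite sub0r normrN uE ger0_norm ?opnorm_ge0 //.
apply: le_trans (opnorm_le _ (hp n).2) _; first by rewrite invr_ge0.
exact: hN.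
Qed.

Lemma bnd0 e : 0 <= e -> bnd (0 : E) e.
Proof. by move=> e0 x; rewrite bop0 rnorm0 mulr_ge0 ?rnorm_ge0. Qed.

Lemma selfadj_lim b : (forall e, 0 < e -> exists c, selfadj ip c /\ bnd (c - b) e) -> selfadj ip b.
Proof.
move=> h; suff le x y : dot (b x) y <= dot x (b y).
  by move=> x y; apply/eqP; rewrite eq_le le /= (dotC ip (b x)) (dotC ip x) le.
apply: (@le_of_eps _ _ _ (2 * (rnorm x * rnorm y))) => e e0.
have [c [hc hb]] := h e e0.
have h1 : dot ((b - c) x) y <= e * rnorm x * rnorm y.
  apply: le_trans (cauchy_schwarz hn hip _ _) _.
  by rewrite ler_wpM2r ?rnorm_ge0 //; apply: bndBC.
have h2 : dot x ((c - b) y) <= rnorm x * (e * rnorm y).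
  apply: le_trans (cauchy_schwarz hn hip _ _) _.
  by rewrite ler_wpM2l ?rnorm_ge0.
move: h1 h2; rewrite !bopB dotBl dotBr hc; lra.
Qed.

Lemma ople_eps a b k : selfadj ip a -> selfadj ip b ->
  (forall e, 0 < e -> a ⊑ b + (e * k)%:A) -> a ⊑ b.
Proof.
move=> ha hb h; apply: ople_dotP => // x.
apply: (@le_of_eps _ _ _ (k * rnorm x ^+ 2)) => e e0.
by have := ople_dot x (h e e0); rewrite bopD bopZ bop1 dotDl dotZl (dotxx hip) mulrA.
Qed.

Lemma bnd_ople2 a b e : selfadj ip a -> selfadj ip b -> bnd (a - b) e -> a ⊑ b + e%:A.
Proof.
move=> ha hb h; have := ople_bnd hip (selfadjB ha hb) h.
by rewrite /ople opprB addrA [e%:A + b]addrC.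
Qed.

Lemma is_calc_selfadj a f b : selfadj ip a -> is_calc a f b -> selfadj ip b.
Proof.
move=> ha h; apply: selfadj_lim => e e0; have [p [_ hp]] := h e e0.
by exists (horner_alg a p); split=> //; exact: selfadj_poly.
Qed.

Lemma is_calc_le a f g b c : selfadj ip a -> is_calc a f b -> is_calc a g c ->
  (forall t, rspec a t -> f t <= g t) -> b ⊑ c.
Proof.
move=> ha hf hg fg; have hb := is_calc_selfadj ha hf; have hc := is_calc_selfadj ha hg.
(* The 4 counts e for each operator approximation and 2 e for the two polynomials on the
   spectrum. *)
apply: (@ople_eps _ _ 4) => // e e0.
have [p [p1 p2]] := hf e e0; have [q [q1 q2]] := hg e e0.
have sp := selfadj_poly p ha; have sq := selfadj_poly q ha.
have h1 : b ⊑ horner_alg a p + e%:A by apply: bnd_ople2 => //; exact: bndBC.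
have h2 : horner_alg a q ⊑ c + e%:A by exact: bnd_ople2.
have h3 : horner_alg a p ⊑ horner_alg a (q + (2 * e)%:P).
  apply: ople_poly => // t st; rewrite hornerD hornerC.
  have := p1 t st; have := q1 t st; have := fg t st.
  by rewrite !ler_norml; lra.
rewrite rmorphD /= horner_algC in h3.
apply: (ople_trans h1); apply: (ople_trans (opleD h3 (ople_refl ip e%:A))).
have -> : c + (e * 4)%:A = (c + e%:A) + (2 * e)%:A + e%:A.
  by rewrite -!addrA -!scalerDl; congr (_ + _ *: _); ring.
by do 2!(apply: opleD; last exact: ople_refl).
Qed.

Lemma is_calc_uniq a f b c : selfadj ip a -> is_calc a f b -> is_calc a f c -> b = c.
Proof. by move=> ha h1 h2; apply: (ople_anti hip); apply: is_calc_le; eauto. Qed.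

Lemma is_calc_ext a f g b : (forall t, rspec a t -> f t = g t) ->
  is_calc a f b -> is_calc a g b.
Proof.
move=> fg h e e0; have [p [p1 p2]] := h e e0.
by exists p; split=> // t st; rewrite -fg ?p1.
Qed.

Lemma is_calc_poly a p : is_calc a (horner p) (horner_alg a p).
Proof.
move=> e e0; exists p; split; last by rewrite subrr; apply: bnd0; exact: ltW.
by move=> t _; rewrite subrr normr0 ltW.
Qed.

Lemma is_calc_const a k : is_calc a (fun=> k) k%:A.
Proof.
by rewrite -(horner_algC a); apply: is_calc_ext (is_calc_poly a _) => t _; rewrite hornerC.
Qed.

Lemma is_calc_id a : is_calc a id a.
Proof.
rewrite -[X in is_calc _ _ X](horner_algX a).
by apply: is_calc_ext (is_calc_poly a _) => t _; rewrite hornerX.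
Qed.

Lemma is_calcD a f g b c : is_calc a f b -> is_calc a g c ->
  is_calc a (fun t => f t + g t) (b + c).
Proof.
move=> hf hg e e0; have e2 : 0 < e / 2 by lra.
have [p [p1 p2]] := hf _ e2; have [q [q1 q2]] := hg _ e2.
exists (p + q); split.
  move=> t st; rewrite hornerD opprD addrACA.
  apply: le_trans (ler_normD _ _) _; have := p1 t st; have := q1 t st; lra.
rewrite rmorphD /= opprD addrACA; apply: bnd_weak (bndD p2 q2); lra.
Qed.

Lemma is_calcM a f g b c : selfadj ip a -> is_calc a f b -> is_calc a g c ->
  is_calc a (fun t => f t * g t) (b * c).
Proof.
move=> ha hf hg e e0.
have [M M0 [lM uM]] := selfadj_bound hip ha.
(* Only approximability of g is known, so its bound on the spectrum comes from a polynomial within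
   distance 1. *)
have [q0 [hq0 _]] := hg 1 ltr01.
have [K0 hK0] := poly_itv_bound q0 (- M) M.
pose K := `|K0| + 1.
have K1 : 1 <= K by rewrite /K; have := normr_ge0 K0; lra.
have gK t : rspec a t -> `|g t| <= K.
  move=> st; have := hK0 t; rewrite (rspec_lower hip lM st) (rspec_upper hip uM st) => /(_ isT) h.
  have := hq0 t st; have := ler_norm K0; rewrite distrC => h1 h2.
  have -> : g t = (g t - q0.[t]) + q0.[t] by rewrite subrK.
  by apply: le_trans (ler_normD _ _) _; rewrite /K; lra.
have [C C0 hC] := bop_bound c.
pose e1 := e / 2 / (K + C + 1).
have e10 : 0 < e1 by rewrite !divr_gt0 //; lra.
have e1E : e1 * (K + C + 1) = e / 2 by rewrite divfK // gt_eqF //; lra.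
have [p [p1 p2]] := hf e1 e10.
have [P hP] := poly_itv_bound p (- M) M.
have [Pa Pa0 hPa] := bop_bound (horner_alg a p).
(* The second polynomial is chosen after p, since its tolerance depends on the size of p on the
   spectrum and of p(a). *)
pose e2 := e / 2 / (`|P| + Pa + 1).
have P0 := normr_ge0 P.
have e20 : 0 < e2 by rewrite !divr_gt0 //; lra.
have e2E : e2 * (`|P| + Pa + 1) = e / 2 by rewrite divfK // gt_eqF //; lra.
have [q [q1 q2]] := hg e2 e20.
exists (p * q); split.
  move=> t st; rewrite hornerM.
  have -> : p.[t] * q.[t] - f t * g t = p.[t] * (q.[t] - g t) + (p.[t] - f t) * g t by ring.
  apply: le_trans (ler_normD _ _) _; rewrite !normrM.
  have hPt : `|p.[t]| <= `|P|.
    apply: le_trans (hP t _) (ler_norm _).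
    by rewrite (rspec_lower hip lM st) (rspec_upper hip uM st).
  have := ler_pM (normr_ge0 _) (normr_ge0 _) hPt (q1 t st).
  have := ler_pM (normr_ge0 _) (normr_ge0 _) (p1 t st) (gK t st).
  have := mulr_ge0 (ltW e10) C0; have := mulr_ge0 (ltW e20) Pa0.
  lra.
rewrite rmorphM /=.
have -> : horner_alg a p * horner_alg a q - b * c =
    horner_alg a p * (horner_alg a q - c) + (horner_alg a p - b) * c.
  by rewrite mulrBr mulrBl addrA subrK.
apply: bnd_weak (bndD (bndM Pa0 hPa q2) (bndM (ltW e10) p2 hC)).
have := mulr_ge0 (ltW e10) (le_trans ler01 K1); have := mulr_ge0 (ltW e20) P0.
lra.
Qed.

Lemma is_calc_lim a f b :
  (forall e, 0 < e -> exists g c, [/\ is_calc a g c,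
     forall t, rspec a t -> `|g t - f t| <= e & bnd (c - b) e]) -> is_calc a f b.
Proof.
move=> h e e0; have e2 : 0 < e / 2 by lra.
have [g [c [hg h1 h2]]] := h _ e2; have [p [p1 p2]] := hg _ e2.
exists p; split.
  move=> t st; have -> : p.[t] - f t = (p.[t] - g t) + (g t - f t) by rewrite addrA subrK.
  apply: le_trans (ler_normD _ _) _; have := p1 t st; have := h1 t st; lra.
have -> : horner_alg a p - b = (horner_alg a p - c) + (c - b) by rewrite addrA subrK.
apply: bnd_weak (bndD p2 h2); lra.
Qed.

Lemma is_calc_dist a f g b c e : 0 < e -> selfadj ip a -> is_calc a f b -> is_calc a g c ->
  (forall t, rspec a t -> `|f t - g t| <= e) -> bnd (b - c) e.
Proof.
move=> e0 ha hf hg fg; have hb := is_calc_selfadj ha hf; have hc := is_calc_selfadj ha hg.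
have le1 d d' : d' ⊑ d + e%:A -> d' - d ⊑ e%:A.
  by rewrite /ople opprB addrA [e%:A + d]addrC.
apply: (bnd_ople hip) => //; first exact: selfadjB.
  rewrite scaleNr -[b - c]opprB; apply: opleN; apply: le1.
  apply: (is_calc_le ha hg (is_calcD hf (is_calc_const a e))) => t /fg.
  by rewrite ler_norml; lra.
apply: le1; apply: (is_calc_le ha hf (is_calcD hg (is_calc_const a e))) => t /fg.
by rewrite ler_norml; lra.
Qed.

(** Polynomials approximating f on [m, M] are uniformly Cauchy on the spectrum; [is_calc_dist] makes
    their values at a Cauchy in norm. *)
Lemma is_calc_exists a f m M : selfadj ip a -> m%:A ⊑ a -> a ⊑ M%:A ->
  poly_approx m M f -> exists b, is_calc a f b.
Proof.
move=> ha lm uM hf.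
have inI t : rspec a t -> m <= t <= M.
  by move=> st; rewrite (rspec_lower hip lm st) (rspec_upper hip uM st).
have hk k : exists p, forall t, m <= t <= M -> `|p.[t] - f t| <= k.+1%:R^-1.
  by apply: hf; rewrite invr_gt0 ltr0Sn.
have [p hp] := choice hk.
have [b hb] : exists b : E, forall e, 0 < e -> exists N : nat, forall n : nat, (N <= n)%N ->
    bnd (horner_alg a (p n) - b) e.
  apply: bop_complete => e e0; have e2 : 0 < e / 2 by lra.
  have [N hN] := natSinv_small e2; exists N => k l kN lN.
  apply: (is_calc_dist e0 ha (is_calc_poly a _) (is_calc_poly a _)) => t /inI tI.
  have -> : (p k).[t] - (p l).[t] = ((p k).[t] - f t) - ((p l).[t] - f t) by ring.
  apply: le_trans (ler_normB _ _) _.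
  apply: le_trans (lerD (hp k t tI) (hp l t tI)) _.
  by rewrite [leRHS](splitr e); apply: lerD; apply: hN.
exists b => e e0; have [N hN] := hb e e0; have [N' hN'] := natSinv_small e0.
exists (p (N + N')%N); split; last by apply: hN; rewrite leq_addr.
by move=> t /inI tI; apply: le_trans (hp _ t tI) _; apply: hN'; rewrite leq_addl.
Qed.

Lemma is_calc_comp_poly a f b q : selfadj ip a -> is_calc a f b ->
  is_calc a (fun t => q.[f t]) (horner_alg b q).
Proof.
move=> ha h; elim/poly_ind: q => [|q k ih].
  rewrite rmorph0 -(scale0r (1 : E)); apply: is_calc_ext (is_calc_const a 0) => t _.
  by rewrite horner0.
rewrite rmorphD rmorphM /= horner_algX horner_algC.
apply: is_calc_ext (is_calcD (is_calcM ha ih h) (is_calc_const a k)) => t _.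
by rewrite hornerMXaddC.
Qed.

(** The range of f gives scalar bounds m and M for b, which place the spectrum of b in [m, M]. One
    polynomial then approximates g both at b and at the values of f. *)
Lemma is_calc_comp a f b g c m M : selfadj ip a -> is_calc a f b -> is_calc b g c ->
  (forall t, rspec a t -> m <= f t <= M) -> poly_approx m M g ->
  is_calc a (fun t => g (f t)) c.
Proof.
move=> ha hf hg fI hap; have hb := is_calc_selfadj ha hf.
have lm : m%:A ⊑ b by apply: (is_calc_le ha (is_calc_const a m) hf) => t /fI /andP[].
have uM : b ⊑ M%:A by apply: (is_calc_le ha hf (is_calc_const a M)) => t /fI /andP[].
apply: is_calc_lim => e e0; have [q hq] := hap e e0.
exists (fun t => q.[f t]), (horner_alg b q); split.
- exact: is_calc_comp_poly.
- by move=> t /fI; exact: hq.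
- apply: (is_calc_dist e0 hb (is_calc_poly b q) hg) => t st; apply: hq.
  by rewrite (rspec_lower hip lm st) (rspec_upper hip uM st).
Qed.

Lemma poly_intertwine a b k p : a * k = k * b ->
  horner_alg a p * k = k * horner_alg b p.
Proof.
move=> h; elim/poly_ind: p => [|p l ih]; first by rewrite !rmorph0 mul0r mulr0.
rewrite !rmorphD !rmorphM /= !horner_algX !horner_algC mulrDl mulrDr.
by rewrite -mulrA h mulrA ih mulrA mulr_algl mulr_algr.
Qed.

(** Polynomials inherit the relation a k = k b. Common bounds for a and b let the same polynomial
    approximate f on both spectra. *)
Lemma is_calc_intertwine a b k f fa fb m M : selfadj ip a -> selfadj ip b ->
  m%:A ⊑ a -> a ⊑ M%:A -> m%:A ⊑ b -> b ⊑ M%:A -> poly_approx m M f ->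
  is_calc a f fa -> is_calc b f fb -> a * k = k * b -> fa * k = k * fb.
Proof.
move=> ha hb lma uMa lmb uMb hap hfa hfb hk.
have [K K0 hK] := bop_bound k.
apply/eqP; rewrite -subr_eq0; apply/eqP; apply: (@bnd_eps_eq0 _ _ _ _ (K + K)) => e e0.
have [p hp] := hap e e0.
have h1 : bnd (horner_alg a p - fa) e.
  apply: (is_calc_dist e0 ha (is_calc_poly a p) hfa) => t st; apply: hp.
  by rewrite (rspec_lower hip lma st) (rspec_upper hip uMa st).
have h2 : bnd (horner_alg b p - fb) e.
  apply: (is_calc_dist e0 hb (is_calc_poly b p) hfb) => t st; apply: hp.
  by rewrite (rspec_lower hip lmb st) (rspec_upper hip uMb st).
have -> : fa * k - k * fb = k * (horner_alg b p - fb) - (horner_alg a p - fa) * k.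
  by rewrite mulrBr mulrBl -(poly_intertwine p hk) opprB [RHS]addrC addrA subrK.
rewrite [e * _]mulrDr; apply: bndB; first by rewrite [e * K]mulrC; exact: bndM.
by apply: bndM => //; exact: ltW.
Qed.

End FunctionalCalculus.

(** * Real powers and the Loewner-Heinz inequality *)

Section Powers.
Context {R : realType} {H : completeNormedModType R[i]}.
Context (hn : exists x : H, x != 0).
Context (ip : {dot H for Num.conj}) (hip : norm_of_inner_product ip).
Local Notation E := (bop hn).
Local Notation "a ⊑ b" := (ople ip a b) (at level 70).
Local Notation dot := (dot ip).
Implicit Types (a b c d : E) (e m r s t M : R) (x y z : H) (p q : {poly R}).
Implicit Types (f g : R -> R).

Definition posinv a := pos ip a /\ a \is a GRing.unit.

Lemma posinv_pos a : posinv a -> pos ip a. Proof. by case. Qed.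
Lemma posinv_selfadj a : posinv a -> selfadj ip a. Proof. by case=> -[]. Qed.
Lemma posinv_unit a : posinv a -> a \is a GRing.unit. Proof. by case. Qed.
Hint Resolve posinv_pos posinv_selfadj posinv_unit : core.

Lemma posinv_lower a : posinv a -> exists2 m, 0 < m & m%:A ⊑ a.
Proof. by move=> [pa ua]; exact: (pos_unit_lower hip). Qed.

Lemma posinv_of_lower a m : 0 < m -> m%:A ⊑ a -> posinv a.
Proof.
move=> m0 h; split; last exact: (ople_unit hip m0 h).
apply: ople_posr h; exact: (posZ (ltW m0) (pos1 hn hip)).
Qed.

Lemma posinv_bounds a : posinv a ->
  exists m M, [/\ 0 < m, 0 < M, m%:A ⊑ a & a ⊑ M%:A].
Proof.
move=> ha; have [m m0 hm] := posinv_lower ha.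
have [M M0 [_ hM]] := selfadj_bound hip (posinv_selfadj ha).
by exists m, M.
Qed.

Lemma posinv_le a b : posinv a -> a ⊑ b -> posinv b.
Proof.
move=> /posinv_lower [m m0 hm] ab; apply: (posinv_of_lower m0).
exact: ople_trans ab.
Qed.

Lemma posinvZ r a : 0 < r -> posinv a -> posinv (r *: a).
Proof.
move=> r0 [pa ua]; split; first exact: posZ (ltW r0) pa.
by rewrite scaler_unit // unitfE gt_eqF.
Qed.

Lemma posinv1 : posinv 1.
Proof. by split; [exact: pos1 | exact: unitr1]. Qed.

Lemma posinv_scalar r : 0 < r -> posinv r%:A.
Proof. by move=> r0; apply: posinvZ posinv1. Qed.

Lemma posinv_conj c a : selfadj ip c -> c \is a GRing.unit -> posinv a -> posinv (c * a * c).
Proof. by move=> hc uc [pa ua]; split; [exact: pos_conj | rewrite !unitrMr]. Qed.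

Lemma posinvV a : posinv a -> posinv a^-1.
Proof.
move=> [pa ua]; split; last by rewrite unitrV.
rewrite -[a^-1]mulr1 -(divrr ua) mulrA; apply: pos_conj => //.
exact/selfadjV/pos_selfadj.
Qed.

Lemma rspec_posinv a t : posinv a -> rspec a t -> 0 < t.
Proof.
by move=> /posinv_lower [m m0 hm] st; apply: lt_le_trans (rspec_lower hip hm st).
Qed.

Definition bpow a r : E := xget 1 [set b | is_calc a (fun t => t `^ r) b]%classic.

Lemma bpow_calc a r : posinv a -> is_calc a (fun t => t `^ r) (bpow a r).
Proof.
move=> ha; have [m [M [m0 M0 lm uM]]] := posinv_bounds ha.
have [b hb] := is_calc_exists hip (posinv_selfadj ha) lm uM (poly_approx_powR M r m0).
by rewrite /bpow; case: xgetP => // /(_ b).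
Qed.

Lemma bpow_uniq a r b : posinv a -> is_calc a (fun t => t `^ r) b -> bpow a r = b.
Proof. by move=> ha h; apply: (is_calc_uniq hip (posinv_selfadj ha) (bpow_calc r ha) h). Qed.

Lemma oppow_bpow a r : posinv a -> oppow a r = bpow a r :> (H -> H).
Proof.
move=> ha; rewrite /oppow /functional_calculus; case: xgetP => [B _ /= hB|h].
  have [pB _] := hB.
  have /is_functional_calculusP hB' : is_functional_calculus a (fun t => t `^ r) (Bop hn pB) by [].
  by rewrite (bpow_uniq ha hB').
by case: (h (bpow a r)); apply/is_functional_calculusP; exact: bpow_calc.
Qed.

Lemma bpowD a r s : posinv a -> bpow a (r + s) = bpow a r * bpow a s.
Proof.
move=> ha; apply: bpow_uniq => //.
apply: is_calc_ext (is_calcM hip (posinv_selfadj ha) (bpow_calc r ha) (bpow_calc s ha)) => t st.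
by rewrite powRD // (gt_eqF (rspec_posinv ha st)) implybT.
Qed.

Lemma bpow1 a : posinv a -> bpow a 1 = a.
Proof.
move=> ha; apply: bpow_uniq => //; apply: is_calc_ext (is_calc_id a) => t st.
by rewrite powRr1 // ltW // (rspec_posinv ha st).
Qed.

Lemma bpow0 a : posinv a -> bpow a 0 = 1.
Proof.
move=> ha; apply: bpow_uniq => //; rewrite -[1](scale1r 1).
by apply: is_calc_ext (is_calc_const a 1) => t st; rewrite powRr0.
Qed.

Lemma bpow_unit a r : posinv a -> bpow a r \is a GRing.unit.
Proof.
move=> ha; apply/unitrP; exists (bpow a (- r)).
by rewrite -!bpowD // addNr subrr bpow0.
Qed.

Lemma bpowN a r : posinv a -> bpow a (- r) = (bpow a r)^-1.
Proof.
move=> ha; apply: (mulrI (bpow_unit r ha)).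
by rewrite -bpowD // subrr bpow0 // divrr ?bpow_unit.
Qed.

Lemma bpow_selfadj a r : posinv a -> selfadj ip (bpow a r).
Proof. by move=> ha; apply: is_calc_selfadj (bpow_calc r ha); auto. Qed.

Lemma bpow_posinv a r : posinv a -> posinv (bpow a r).
Proof.
move=> ha; split; last exact: bpow_unit.
by rewrite (splitr r) bpowD //; apply: pos_sq => //; exact: bpow_selfadj.
Qed.

Lemma bpow_bpow a r s : posinv a -> bpow (bpow a r) s = bpow a (r * s).
Proof.
move=> ha; have hb := bpow_posinv r ha.
have [m [M [m0 M0 lm uM]]] := posinv_bounds ha.
have [m' [M' [m'0 hr]]] := powR_range M r m0.
symmetry; apply: bpow_uniq => //.
apply: is_calc_ext (is_calc_comp hip (posinv_selfadj ha) (bpow_calc r ha) (bpow_calc s hb) _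
  (poly_approx_powR M' s m'0)) => t st; first by rewrite powRrM.
by apply: hr; rewrite (rspec_lower hip lm st) (rspec_upper hip uM st).
Qed.

Lemma bpowZ k a r : 0 < k -> posinv a -> bpow (k *: a) r = (k `^ r) *: bpow a r.
Proof.
move=> k0 ha; have hb := posinvZ k0 ha.
have [m [M [m0 M0 lm uM]]] := posinv_bounds ha.
have km0 : 0 < k * m by rewrite mulr_gt0.
apply: (is_calc_uniq hip (posinv_selfadj ha) (f := fun t => k `^ r * t `^ r)); last first.
  rewrite -mulr_algl; apply: (is_calcM hip (posinv_selfadj ha) (is_calc_const a _) (bpow_calc r ha)).
have hk : is_calc a (fun t => k * t) (k *: a).
  rewrite -mulr_algl; apply: (is_calcM hip (posinv_selfadj ha) (is_calc_const a _) (is_calc_id a)).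
apply: is_calc_ext (is_calc_comp hip (posinv_selfadj ha) hk (bpow_calc r hb) _
  (poly_approx_powR (k * M) r km0)) => t st.
  by rewrite powRM // ltW // (rspec_posinv ha st).
by rewrite !ler_pM2l // (rspec_lower hip lm st) (rspec_upper hip uM st).
Qed.

Lemma bpow1l r : bpow 1 r = 1.
Proof.
apply: bpow_uniq; first exact: posinv1.
rewrite -[X in is_calc _ _ X](scale1r 1); apply: is_calc_ext (is_calc_const 1 1) => t st.
have -> : t = 1; last by rewrite powR1.
have h1 : 1%:A ⊑ (1 : E) by rewrite scale1r; exact: ople_refl.
have h2 : (1 : E) ⊑ 1%:A by rewrite scale1r; exact: ople_refl.
by apply/eqP; rewrite eq_le (rspec_lower hip h1 st) (rspec_upper hip h2 st).
Qed.

Lemma bpow_scalar k r : 0 < k -> bpow k%:A r = (k `^ r)%:A.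
Proof. by move=> k0; rewrite bpowZ //; [rewrite bpow1l | exact: posinv1]. Qed.

Lemma bpowV a r : posinv a -> bpow a^-1 r = bpow a (- r).
Proof.
by move=> ha; rewrite -{1}(bpow1 ha) -bpowN // bpow_bpow // mulN1r.
Qed.

Lemma bpow_half a : posinv a -> bpow a 2^-1 * bpow a 2^-1 = a.
Proof.
move=> ha; rewrite -bpowD //; have -> : 2^-1 + 2^-1 = 1 :> R by lra.
exact: bpow1.
Qed.

Lemma bpow_intertwine a b k r : posinv a -> posinv b ->
  a * k = k * b -> bpow a r * k = k * bpow b r.
Proof.
move=> ha hb; have [m [M [m0 M0 lm uM]]] := posinv_bounds ha.
have [m' [M' [m'0 M'0 lm' uM']]] := posinv_bounds hb.
have mm : 0 < Num.min m m' by rewrite lt_min m0.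
apply: (is_calc_intertwine hip (posinv_selfadj ha) (posinv_selfadj hb) (m := Num.min m m') (M := Num.max M M')
  _ _ _ _ (poly_approx_powR _ r mm) (bpow_calc r ha) (bpow_calc r hb)).
- by apply: ople_trans lm; apply: ople_scalar => //; rewrite ge_min lexx.
- by apply: (ople_trans uM); apply: ople_scalar => //; rewrite le_max lexx.
- by apply: ople_trans lm'; apply: ople_scalar => //; rewrite ge_min lexx orbT.
- by apply: (ople_trans uM'); apply: ople_scalar => //; rewrite le_max lexx orbT.
Qed.

Lemma bpow_young a s : posinv a -> 0 <= s <= 1 ->
  bpow a s ⊑ (1 - s)%:A + s *: a.
Proof.
move=> ha sI; apply: (is_calc_le hip (posinv_selfadj ha) (bpow_calc s ha) (g := fun t => 1 - s + s * t)).
  apply: is_calcD; first exact: is_calc_const.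
  by rewrite -mulr_algl; exact: (is_calcM hip (posinv_selfadj ha) (is_calc_const a _) (is_calc_id a)).
by move=> t /(rspec_posinv ha); exact: powR_young.
Qed.

Lemma pos_le1_inv a : posinv a -> 1 ⊑ a -> a^-1 ⊑ 1.
Proof.
move=> ha h; have hb := bpow_posinv (- 2^-1) ha.
have := ople_conj (posinv_selfadj hb) h.
have -> : bpow a (- 2^-1) * a * bpow a (- 2^-1) = 1.
  rewrite -{2}(bpow1 ha) -!bpowD //; have -> : - 2^-1 + 1 + - 2^-1 = 0 :> R by lra.
  by rewrite bpow0.
rewrite mulr1 -bpowD //; have -> : - 2^-1 + - 2^-1 = -1 :> R by lra.
by rewrite bpowN // bpow1.
Qed.

(** Conjugation by v = a^(-1/2) reduces the claim to 1 ⊑ v b v, which [pos_le1_inv] inverts;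
    conjugating by v once more returns to a and b. *)
Lemma ople_inv a b : posinv a -> a ⊑ b -> b^-1 ⊑ a^-1.
Proof.
move=> ha ab; have hb := posinv_le ha ab.
have hw := bpow_posinv 2^-1 ha; set w := bpow a 2^-1 in hw.
have ww : w * w = a by exact: bpow_half.
have hv := posinvV hw; set v := w^-1 in hv.
have uw := posinv_unit hw; have uv := posinv_unit hv; have ub := posinv_unit hb.
have vw : v * w = 1 by rewrite mulVr. have wv : w * v = 1 by rewrite divrr.
have vav : v * a * v = 1 by rewrite -ww mulrA vw mul1r wv.
have := ople_conj (posinv_selfadj hv) ab; rewrite vav => h.
have := pos_le1_inv (posinv_conj (posinv_selfadj hv) uv hb) h.
have uvb : v * b \is a GRing.unit by rewrite unitrMr.
have vV : v^-1 = w by exact: invrK.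
rewrite (invrM uvb uv) (invrM uv ub) vV mulrA => h2.
have := ople_conj (posinv_selfadj hv) h2.
rewrite !mulrA vw mul1r -mulrA wv !mulr1.
by have -> : v * v = a^-1 by rewrite -ww invrM.
Qed.

Lemma adjoint_bnd a b M : (forall x y, dot (a x) y = dot x (b y)) -> 0 <= M ->
  bnd a M -> bnd b M.
Proof.
move=> hab M0 hM y; have [->|n0] := eqVneq (rnorm (b y)) 0.
  by rewrite mulr_ge0 ?rnorm_ge0.
have np : 0 < rnorm (b y) by rewrite lt_def n0 rnorm_ge0.
rewrite -(ler_pM2l np) -expr2 -(dotxx hip) -hab.
apply: le_trans (cauchy_schwarz hn hip _ _) _.
rewrite mulrCA mulrA ler_wpM2r ?rnorm_ge0 //.
Qed.

Lemma ople1_of_pow_bnd a C : pos ip a -> 0 <= C -> (forall n : nat, bnd (a ^+ n) C) -> a ⊑ 1.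
Proof.
move=> pa C0 hC; apply: ople_dotP (pos_selfadj pa) _ _; first exact: selfadj1.
move=> x; rewrite bop1 leNgt; apply/negP => lt.
have [x0|xn0] := eqVneq (dot x x) 0.
  have := cauchy_schwarz hn hip (a x) x; rewrite leNgt => /negP; apply.
  by have := dot_eq0 hip x0 => x00; rewrite x00 rnorm0 mulr0; move: lt; rewrite x0 {1 2}x00.
have N0 : 0 < dot x x by rewrite lt_def xn0 dotxx_ge0.
pose g k : R := dot ((a ^+ (2 ^ k)) x) x / dot x x.
(* Cauchy-Schwarz makes dot (a^(2^k) x) x / dot x x grow at least like its 2^k-th power. *)
have gS k : g k ^+ 2 <= g k.+1.
  have sk : selfadj ip (a ^+ (2 ^ k)) by apply: selfadjX; exact: pos_selfadj.
  have := pos_cauchy_schwarz ((a ^+ (2 ^ k)) x) x (pos1 hn hip).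
  rewrite !bop1 -sk -bopM -exprD addnn -mul2n -expnS => h.
  by rewrite /g expr_div_n ler_pdivrMr ?exprn_gt0 // expr2 [X in _ <= X]mulrA divfK ?gt_eqF //.
have g1 : 1 < g 0%N by rewrite /g expn0 expr1 ltr_pdivlMr // mul1r.
have gk k : g 0%N ^+ (2 ^ k) <= g k.
  elim: k => [|k ih]; first by rewrite expn0 expr1.
  have p0 : 0 <= g 0%N ^+ (2 ^ k) by rewrite exprn_ge0 //; lra.
  rewrite expnS mulnC exprM; apply: le_trans (gS k).
  by rewrite ler_pXn2r // nnegrE // (le_trans p0).
have gC k : g k <= C.
  rewrite /g ler_pdivrMr //; apply: le_trans (cauchy_schwarz hn hip _ _) _.
  rewrite (dotxx hip) expr2 mulrA ler_wpM2r ?rnorm_ge0 //; exact: hC.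
have i0 : 0 <= (g 0%N)^-1 by rewrite invr_ge0; lra.
have i1 : (g 0%N)^-1 < 1 by rewrite invf_lt1; lra.
have C1 : 0 < (C + 1)^-1 by rewrite invr_gt0; lra.
have [N hN] := expr_small i0 i1 C1.
have := hN (2 ^ N)%N (ltnW (ltn_expl N (ltnSn 1))).
rewrite exprVn lef_pV2 ?posrE ?exprn_gt0 //; try lra.
by have := gk N; have := gC N; lra.
Qed.

Lemma similar_expr d d' k n : d' * d = 1 -> d * d' = 1 ->
  (d * k * d') ^+ n = d * k ^+ n * d'.
Proof.
move=> h1 h2; elim: n => [|n ih]; first by rewrite !expr0 mulr1.
by rewrite !exprSr ih !mulrA -[_ * d' * d]mulrA h1 mulr1.
Qed.

Lemma loewner_heinz_mid a b s t : posinv a -> posinv b ->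
  bpow a s ⊑ bpow b s -> bpow a t ⊑ bpow b t ->
  bpow a ((s + t) / 2) ⊑ bpow b ((s + t) / 2).
Proof.
move=> ha hb hs ht.
(* The order relation between the r-th powers, evaluated at b^(-r/2) x, says that a^(r/2) b^(-r/2)
   is a contraction. *)
have half r : bpow a r ⊑ bpow b r -> bnd (bpow a (r / 2) * bpow b (- (r / 2))) 1.
  move=> hr x; rewrite mul1r -(ler_pXn2r (ltn0Sn 1)) ?nnegrE ?rnorm_ge0 //.
  rewrite -!(dotxx hip) bopM; set y := bpow b _ x.
  have -> : dot (bpow a (r / 2) y) (bpow a (r / 2) y) = dot (bpow a r y) y.
    by rewrite [in RHS](splitr r) bpowD // bopM [RHS](bpow_selfadj _ ha).
  apply: le_trans (ople_dot y hr) _.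
  have yx : bpow b (r / 2) y = x by rewrite /y -bopM -bpowD // subrr bpow0.
  by rewrite (splitr r) bpowD // bopM (bpow_selfadj _ hb) yx.
(* [T] below is similar to [K], a product of two contractions, so its powers
   are uniformly bounded; being positive, it is then at most 1. *)
pose p := (s + t) / 4.
pose K := bpow b (- (s / 2)) * bpow a (p + p) * bpow b (- (t / 2)).
have KE : K = (bpow b (- (s / 2)) * bpow a (s / 2)) * (bpow a (t / 2) * bpow b (- (t / 2))).
  rewrite mulrA -[_ * bpow a (s / 2) * _]mulrA -bpowD // /K; congr (_ * bpow _ _ * _); rewrite /p; lra.
have bK : bnd K 1.
  have h1 : bnd (bpow b (- (s / 2)) * bpow a (s / 2)) 1.
    apply: (@adjoint_bnd (bpow a (s / 2) * bpow b (- (s / 2)))); [|exact: ler01|exact: half].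
    by move=> x y; rewrite !bopM (bpow_selfadj _ ha) (bpow_selfadj _ hb).
  by rewrite KE; have := bndM ler01 h1 (half t ht); rewrite mulr1.
(* Since s/2 + t/2 = 2 p, this similarity turns the outer factors b^(-s/2) and b^(-t/2) of K both
   into b^(-p), which makes the result symmetric. *)
pose D := bpow b (s / 2 - p); pose D' := bpow b (p - s / 2).
have DD' : D' * D = 1 by rewrite -bpowD // subrKA subrr bpow0.
pose T := bpow b (- p) * bpow a (p + p) * bpow b (- p).
have TE : T = D * K * D'.
  rewrite /K /D /D' !mulrA -bpowD // -[LHS]mulrA -[RHS]mulrA -!mulrA -bpowD // !mulrA.
  by congr (bpow _ _ * _ * bpow _ _); rewrite /p; lra.
have pT : pos ip T.
  by apply: pos_conj; [exact: bpow_selfadj|apply: posinv_pos; exact: bpow_posinv].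
have DD : D * D' = 1 by rewrite -bpowD // subrKA subrr bpow0.
have TX n : T ^+ n = D * K ^+ n * D' by rewrite TE similar_expr.
have [C1 C10 hC1] := bop_bound D; have [C2 C20 hC2] := bop_bound D'.
have T1 : T ⊑ 1.
  apply: (@ople1_of_pow_bnd _ (C1 * 1 * C2)) => //; first by rewrite mulr1 mulr_ge0.
  move=> n; rewrite TX; apply: bndM => //; first by rewrite mulr1.
  by apply: bndM => //; rewrite -(expr1n _ n); exact: bndX.
have := ople_conj (bpow_selfadj p hb) T1.
rewrite /T !mulrA -bpowD // subrr bpow0 // mul1r -mulrA -bpowD // addNr bpow0 // !mulr1 -bpowD //.
by have -> : p + p = (s + t) / 2 by rewrite /p; lra.
Qed.

(** As k is the sum of its lower and upper halves, k / 2^(n+1) is the midpoint of two fractions with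
    denominator 2^n; the exponents 0 and 1 start the induction. *)
Lemma loewner_heinz_dyadic a b (n k : nat) : posinv a -> posinv b -> a ⊑ b ->
  (k <= 2 ^ n)%N -> bpow a (k%:R / (2 ^ n)%:R) ⊑ bpow b (k%:R / (2 ^ n)%:R).
Proof.
move=> ha hb ab; elim: n k => [|n ih] k.
  rewrite expn0 divr1; case: k => [|[|//]] _; first by rewrite !bpow0 //; exact: ople_refl.
  by rewrite !bpow1.
rewrite expnS => hk.
have kE := odd_double_half k.
have h2 : (2 ^ n)%:R != 0 :> R by rewrite pnatr_eq0 expn_eq0.
have -> : k%:R / (2 * 2 ^ n)%:R =
    (k./2%:R / (2 ^ n)%:R + (k./2 + odd k)%:R / (2 ^ n)%:R) / 2 :> R.
  by rewrite -{1}kE -muln2 natrM !natrD natrM; field.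
apply: loewner_heinz_mid => //; apply: ih; lia.
Qed.

(** Quantitative continuity in the exponent: replacing s by a nearby s' costs a factor close to 1,
    uniformly for t in [1/D, D]. *)
Lemma powR_dist_le D t s s' : 1 <= D -> D^-1 <= t <= D -> t `^ s <= D `^ `|s - s'| * t `^ s'.
Proof.
move=> D1 /andP[h1 h2]; have D0 : 0 < D by lra.
have t0 : 0 < t by apply: lt_le_trans h1; rewrite invr_gt0.
rewrite !powRE // -expRD ler_expR -lerBlDr -mulrBl.
apply: le_trans (ler_norm _) _; rewrite normrM ler_wpM2l // ler_norml -lnV ?posrE //.
by rewrite !ler_ln ?posrE ?invr_gt0 // h1 h2.
Qed.

Lemma bpow_dist_le a D s s' : posinv a -> 1 <= D -> D^-1%:A ⊑ a -> a ⊑ D%:A ->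
  bpow a s ⊑ (D `^ `|s - s'|) *: bpow a s'.
Proof.
move=> ha D1 lD uD.
apply: (is_calc_le hip (posinv_selfadj ha) (bpow_calc s ha) (g := fun t => D `^ `|s - s'| * t `^ s')).
  by rewrite -mulr_algl; exact: (is_calcM hip (posinv_selfadj ha) (is_calc_const a _) (bpow_calc s' ha)).
move=> t st; apply: powR_dist_le => //.
by rewrite (rspec_lower hip lD st) (rspec_upper hip uD st).
Qed.

(** The exponent s is replaced by a dyadic one for a, and restored for b after the dyadic case. Each
    change costs a factor at most D^(1/n), which tends to 1. *)
Theorem loewner_heinz a b s : posinv a -> a ⊑ b -> 0 <= s <= 1 -> bpow a s ⊑ bpow b s.
Proof.
move=> ha ab /andP[s0 s1]; have hb := posinv_le ha ab.
have [m [_ [m0 _ lm _]]] := posinv_bounds ha.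
have [_ [M [_ M0 _ uM]]] := posinv_bounds hb.
(* With this D both a and b lie between 1/D and D, as [bpow_dist_le] requires. *)
pose D := 1 + m^-1 + M.
have mi : 0 < m^-1 by rewrite invr_gt0.
have D1 : 1 <= D by rewrite /D; lra.
have D0 : 0 < D by lra.
have Dm : D^-1 <= m by rewrite -[leRHS]invrK lef_pV2 ?posrE // /D; lra.
have lD : D^-1%:A ⊑ a by apply: ople_trans lm; exact: ople_scalar.
have uD : b ⊑ D%:A by apply: (ople_trans uM); apply: ople_scalar => //; rewrite /D; lra.
have [K [_ hK]] : exists K, 0 < K /\ bpow b s ⊑ K%:A.
  by have [K K0 [_ hK]] := selfadj_bound hip (bpow_selfadj s hb); exists K.
apply: (@ople_eps _ _ _ _ hip _ _ ((D ^+ 2 - 1) * K)); [exact: bpow_selfadj|exact: bpow_selfadj|].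
move=> e e0; have [N hN] := natSinv_small e0.
pose n := (2 ^ N)%N; have n0 : 0 < n%:R :> R by rewrite ltr0n expn_gt0.
have nV : n%:R^-1 <= e.
  apply: le_trans (hN N (leqnn _)); rewrite lef_pV2 ?posrE // ler_nat.
  exact: ltn_expl.
pose k := Num.truncn (s * n%:R).
have /andP[k1 k2] : k%:R <= s * n%:R < k.+1%:R by apply: truncn_itv; rewrite mulr_ge0 // ltW.
have kn : (k <= n)%N.
  by rewrite -(ler_nat R); apply: (le_trans k1); rewrite ler_piMl // ltW.
pose s' : R := k%:R / n%:R.
have ds : `|s - s'| <= n%:R^-1.
  have : s' <= s by rewrite /s' ler_pdivrMr.
  have : s - s' <= n%:R^-1.
    rewrite /s' -(ler_pM2r n0) mulrBl divfK ?gt_eqF // mulVf ?gt_eqF //.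
    by move: k2; rewrite -natr1; lra.
  by rewrite ler_norml; have := n0; rewrite -invr_gt0; lra.
have hD : D `^ `|s - s'| <= D `^ n%:R^-1 by apply: ler_powR.
(* Young's inequality with exponent 1/n, applied to D^2. Multiplied by the bound K of b^s, the
   excess over 1 becomes the additive scalar that [ople_eps] allows. *)
have hD2 : D `^ n%:R^-1 * D `^ n%:R^-1 <= 1 + e * (D ^+ 2 - 1).
  have -> : D `^ n%:R^-1 * D `^ n%:R^-1 = (D ^+ 2) `^ n%:R^-1 by rewrite expr2 powRM // ltW.
  have nV1 : 0 <= (n%:R^-1 : R) <= 1.
    by rewrite invr_ge0 ltW //= invf_le1 // ler1n expn_gt0.
  have := powR_young nV1 (exprn_gt0 2 D0).
  have D2 : 0 <= D ^+ 2 - 1 by rewrite subr_ge0 exprn_ege1.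
  have := ler_wpM2r D2 nV; lra.
have h1 := bpow_dist_le s s' ha D1 lD (ople_trans ab uD).
have h2 := loewner_heinz_dyadic ha hb ab kn.
have h3 := bpow_dist_le s' s hb D1 (ople_trans lD ab) uD.
have pD : 0 <= D `^ `|s - s'| by exact: powR_ge0.
apply: (ople_trans h1); apply: (ople_trans (opleZ pD h2)).
apply: (ople_trans (opleZ pD h3)).
rewrite scalerA [`|s' - s|]distrC.
have pb := posinv_pos (bpow_posinv s hb).
have hDD : D `^ `|s - s'| * D `^ `|s - s'| <= 1 + e * (D ^+ 2 - 1).
  by apply: le_trans hD2; apply: ler_pM.
apply: (ople_trans (opleZr pb hDD)).
rewrite scalerDl scale1r; apply: opleD; first exact: ople_refl.
rewrite [e * (_ * K)]mulrA -[X in _ ⊑ X]scalerA; apply: opleZ hK.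
by apply: mulr_ge0; rewrite ?subr_ge0 ?exprn_ege1 // ltW.
Qed.

End Powers.

(** * Weighted geometric means *)

Section GeometricMean.
Context {R : realType} {H : completeNormedModType R[i]}.
Context (hn : exists x : H, x != 0).
Context (ip : {dot H for Num.conj}) (hip : norm_of_inner_product ip).
Local Notation E := (bop hn).
Local Notation "a ⊑ b" := (ople ip a b) (at level 70).
Local Notation posinv := (posinv ip).
Implicit Types (a b c d X Y B : E) (e k m r s t al : R).

Hint Resolve posinv_pos posinv_selfadj posinv_unit : core.

Definition gmean al X B : E :=
  bpow X 2^-1 * bpow (bpow X (- 2^-1) * B * bpow X (- 2^-1)) al * bpow X 2^-1.

Lemma geometric_meanE al X B : posinv X -> posinv B ->
  geometric_mean al X B = gmean al X B :> (H -> H).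
Proof.
move=> hX hB; rewrite /geometric_mean !(oppow_bpow hip) //.
have -> : bpow X (- 2^-1) \o B \o bpow X (- 2^-1) =
    (bpow X (- 2^-1) * B * bpow X (- 2^-1) : E) :> (H -> H) by [].
rewrite (oppow_bpow hip) //.
by apply: posinv_conj => //; [exact: bpow_selfadj | exact: bpow_unit].
Qed.

Section Pair.
Context (X B : E) (hX : posinv X) (hB : posinv B).
Let u := bpow X 2^-1.
Let v := bpow X (- 2^-1).

Let pu : posinv u. Proof. exact: bpow_posinv. Qed.
Let pv : posinv v. Proof. exact: bpow_posinv. Qed.
Let uv : u * v = 1. Proof. by rewrite -(bpowD hip) // subrr (bpow0 hip). Qed.
Let vu : v * u = 1. Proof. by rewrite -(bpowD hip) // addNr (bpow0 hip). Qed.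
Let uu : u * u = X. Proof. exact: bpow_half. Qed.
Let vV : v = u^-1. Proof. by rewrite -(bpowN hip). Qed.

Lemma gmean_inner_posinv : posinv (bpow X (- 2^-1) * B * bpow X (- 2^-1)).
Proof. exact: posinv_conj (posinv_selfadj pv) (posinv_unit pv) hB. Qed.

Let pP := gmean_inner_posinv.

Lemma gmean_posinv al : posinv (gmean al X B).
Proof. by apply: posinv_conj (posinv_selfadj pu) (posinv_unit pu) _; exact: bpow_posinv. Qed.

(** For v = X^(-1/2) and w = B^(1/2), v B v = (v w)(w v) and w X^-1 w = (w v)(v w). Hence v w
    intertwines the two operators, and so their powers. *)
Lemma gmean_dual al :
  gmean al X B = bpow B 2^-1 * bpow (bpow B 2^-1 * X^-1 * bpow B 2^-1) (al - 1) * bpow B 2^-1.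
Proof.
set w := bpow B 2^-1; have pw : posinv w by exact: bpow_posinv.
have ww : w * w = B by exact: bpow_half.
have XV : X^-1 = v * v.
  have -> : X^-1 = (u * u)^-1 by rewrite uu.
  by rewrite (invrM (posinv_unit pu) (posinv_unit pu)) -vV.
have pQ : posinv (w * X^-1 * w).
  by apply: posinv_conj (posinv_selfadj pw) (posinv_unit pw) _; exact: posinvV.
have itw : (v * B * v) * (v * w) = (v * w) * (w * X^-1 * w).
  by rewrite XV -ww !mulrA.
have h := bpow_intertwine hip (al - 1) pP pQ itw.
rewrite /gmean -/u -/v -[al in LHS](subrK 1) (bpowD hip _ _ pP) (bpow1 hip pP).
have PE : v * B * v = (v * w) * (w * v) by rewrite -ww !mulrA.
by rewrite {2}PE [bpow _ _ * _]mulrA h !mulrA uv mul1r -mulrA vu mulr1.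
Qed.

(** After conjugation by X^(-1/2) the curve of means from X to B consists of the powers of one
    operator. *)
Lemma gmean_gm al r : gmean al X (gmean r X B) = gmean (r * al) X B.
Proof.
rewrite /gmean -/u -/v; congr (_ * _ * _).
by rewrite !mulrA vu mul1r -mulrA uv mulr1 (bpow_bpow hip).
Qed.

Lemma gmean_young al s : 0 <= s <= 1 ->
  gmean (al * s) X B ⊑ (1 - s) *: X + s *: gmean al X B.
Proof.
move=> sI; rewrite /gmean -/u -/v -(bpow_bpow hip _ _ pP).
have := ople_conj (posinv_selfadj pu) (bpow_young hip (bpow_posinv hip al pP) sI).
rewrite [u * (_ + _)]mulrDr mulrDl -!scalerAr mulr1 -!scalerAl uu //.
Qed.

Lemma gmean_inv al : (gmean al X B)^-1 = gmean al X^-1 B^-1.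
Proof.
have pw := bpow_posinv hip al pP.
have u1 : bpow X 2^-1 * bpow (bpow X (- 2^-1) * B * bpow X (- 2^-1)) al \is a GRing.unit.
  by rewrite unitrMr ?(posinv_unit pu) ?(posinv_unit pw).
rewrite /gmean (invrM u1 (posinv_unit pu)) (invrM (posinv_unit pu) (posinv_unit pw)) mulrA.
rewrite !(bpowV hip) // opprK -/u -/v -vV -(bpowN hip _ pP) -(bpowV hip _ pP).
congr (_ * bpow _ _ * _).
have uB : v * B \is a GRing.unit by rewrite unitrMr ?(posinv_unit pv) ?(posinv_unit hB).
rewrite -/v (invrM uB (posinv_unit pv)) (invrM (posinv_unit pv) (posinv_unit hB)) mulrA.
by rewrite vV invrK.
Qed.

Lemma gmean_scalar_l al k : 0 < k -> gmean al k%:A B = k `^ (1 - al) *: bpow B al.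
Proof.
move=> k0; have kh r : bpow k%:A r = (k `^ r)%:A :> E by apply: bpow_scalar.
rewrite /gmean !kh !mulr_algl !mulr_algr !scalerA.
have D r s : k `^ r * k `^ s = k `^ (r + s).
  by rewrite powRD // (gt_eqF k0) implybT.
rewrite !D (bpowZ hip) ?powR_gt0 // scalerA -powRrM D; congr (_ `^ _ *: _); lra.
Qed.

Lemma gmean_scale_r al k : 0 < k -> gmean al X (k *: B) = k `^ al *: gmean al X B.
Proof.
move=> k0; rewrite /gmean -scalerAr -scalerAl (bpowZ hip _ k0 pP).
by rewrite -scalerAr -scalerAl.
Qed.

End Pair.

(** In the dual form X enters inverted and under the exponent -(1 - al): the two order reversals
    cancel around the Loewner-Heinz inequality. *)
Lemma gmean_mono_l al X Y B : 0 <= al <= 1 -> posinv X -> posinv B -> X ⊑ Y ->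
  gmean al X B ⊑ gmean al Y B.
Proof.
move=> /andP[al0 al1] hX hB XY; have hY := posinv_le hip hX XY.
rewrite !gmean_dual //; have hw := bpow_posinv hip 2^-1 hB.
apply: ople_conj; first by auto.
have pQ Z : posinv Z -> posinv (bpow B 2^-1 * Z^-1 * bpow B 2^-1).
  by move=> hZ; apply: posinv_conj (posinv_selfadj hw) (posinv_unit hw) _; exact: posinvV.
have aI : 0 <= 1 - al <= 1 by lra.
have -> : al - 1 = - (1 - al) by ring.
rewrite (bpowN hip _ (pQ _ hX)) (bpowN hip _ (pQ _ hY)).
apply: (ople_inv hip); first by apply: bpow_posinv => //; exact: pQ.
apply: loewner_heinz => //; first exact: pQ.
by apply: ople_conj; auto; exact: ople_inv.
Qed.

Lemma gmean_mono_r al X B B' : 0 <= al <= 1 -> posinv X -> posinv B -> B ⊑ B' ->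
  gmean al X B ⊑ gmean al X B'.
Proof.
move=> aI hX hB BB; apply: ople_conj; first by apply: posinv_selfadj; exact: bpow_posinv.
apply: loewner_heinz => //; first exact: gmean_inner_posinv.
by apply: ople_conj => //; exact: bpow_selfadj.
Qed.

Lemma gmean_scale_l al k X B : 0 < k -> posinv X -> posinv B ->
  gmean al (k *: X) B = k `^ (1 - al) *: gmean al X B.
Proof.
move=> k0 hX hB; rewrite !gmean_dual //; last exact: posinvZ.
have uk : k \is a GRing.unit by rewrite unitfE gt_eqF.
rewrite (invrZ uk (posinv_unit hX)) -scalerAr -scalerAl (bpowZ hip) ?invr_gt0 //.
  rewrite -scalerAr -scalerAl; congr (_ *: _).
  by rewrite -powR_inv1 ?ltW // -powRrM; congr (_ `^ _); ring.
have hw := bpow_posinv hip 2^-1 hB.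
by apply: posinv_conj (posinv_selfadj hw) (posinv_unit hw) _; exact: posinvV.
Qed.

End GeometricMean.

(** * Power means *)

Section PowerMean.
Context {R : realType} {H : completeNormedModType R[i]}.
Context (hn : exists x : H, x != 0).
Context (ip : {dot H for Num.conj}) (hip : norm_of_inner_product ip).
Local Notation E := (bop hn).
Local Notation "a ⊑ b" := (ople ip a b) (at level 70).
Local Notation posinv := (posinv ip).
Context (n : nat) (w : 'I_n -> R) (w_prob : probability_vector w).
Context (al : R) (al0 : 0 < al) (al1 : al <= 1).
Implicit Types (a b c d X Y B : E) (e m r s t M lam : R) (A : 'I_n -> E).

Let q : R := 1 - al.
Let q0 : 0 <= q. Proof. by rewrite subr_ge0. Qed.
Let q1 : q < 1. Proof. by rewrite -subr_gt0 opprB addrC subrK. Qed.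
Let alI : 0 <= al <= 1. Proof. by rewrite al1 ltW. Qed.

Definition mean_map A X : E := \sum_(j < n) w j *: gmean al X (A j).

Lemma sum_weights b : \sum_(j < n) w j *: b = b.
Proof. by rewrite -scaler_suml w_prob.2 scale1r. Qed.

Lemma gmean_idem (k : R) : 0 < k -> gmean al k%:A k%:A = (k%:A : E).
Proof.
move=> k0; rewrite (gmean_scalar_l hip) //; last exact: posinv_scalar.
rewrite (bpow_scalar _ hip) // scalerA -powRD; last by rewrite (gt_eqF k0) implybT.
by rewrite subrK powRr1 // ltW.
Qed.

Lemma gmean_ge m X B : 0 < m -> m%:A ⊑ X -> m%:A ⊑ B -> m%:A ⊑ gmean al X B.
Proof.
move=> m0 hX hB; rewrite -{1}(gmean_idem m0).
apply: (ople_trans (gmean_mono_l hip alI _ _ hX)); try exact: posinv_scalar.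
by apply: gmean_mono_r => //; [exact: posinv_of_lower hX | exact: posinv_scalar].
Qed.

Lemma gmean_le M X B : 0 < M -> posinv X -> posinv B -> X ⊑ M%:A -> B ⊑ M%:A ->
  gmean al X B ⊑ M%:A.
Proof.
move=> M0 pX pB hX hB; rewrite -[X in _ ⊑ X](gmean_idem M0).
apply: (ople_trans (gmean_mono_l hip alI pX pB hX)).
by apply: gmean_mono_r => //; exact: posinv_scalar.
Qed.

Lemma mean_map_le A A' X Y : (forall j, gmean al X (A j) ⊑ gmean al Y (A' j)) ->
  mean_map A X ⊑ mean_map A' Y.
Proof. by move=> h; apply: ople_sum => j; apply: opleZ => //; exact: w_prob.1. Qed.

Lemma mean_map_mono A X Y : (forall j, posinv (A j)) -> posinv X -> X ⊑ Y ->
  mean_map A X ⊑ mean_map A Y.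
Proof. by move=> hA hX XY; apply: mean_map_le => j; exact: gmean_mono_l. Qed.

Lemma mean_map_ge A m X : 0 < m -> m%:A ⊑ X -> (forall j, m%:A ⊑ A j) -> m%:A ⊑ mean_map A X.
Proof.
move=> m0 hX hA; rewrite -[X in X ⊑ _]sum_weights; apply: ople_sum => j.
by apply: opleZ; [exact: w_prob.1 | exact: gmean_ge].
Qed.

Lemma mean_map_upper A M X : 0 < M -> posinv X -> (forall j, posinv (A j)) ->
  X ⊑ M%:A -> (forall j, A j ⊑ M%:A) -> mean_map A X ⊑ M%:A.
Proof.
move=> M0 pX pA hX hA; rewrite -[X in _ ⊑ X]sum_weights; apply: ople_sum => j.
by apply: opleZ; [exact: w_prob.1 | exact: gmean_le].
Qed.

Lemma mean_map_scale A (k : R) X : (forall j, posinv (A j)) -> posinv X -> 0 < k ->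
  mean_map A (k *: X) = k `^ q *: mean_map A X.
Proof.
move=> hA hX k0; rewrite /mean_map scaler_sumr; apply: eq_bigr => j _.
by rewrite (gmean_scale_l hip) // !scalerA mulrC.
Qed.

Lemma family_bounds A : (forall j, posinv (A j)) ->
  exists m M, [/\ 0 < m, 0 < M, m <= M, forall j, m%:A ⊑ A j & forall j, A j ⊑ M%:A].
Proof.
move=> hA; have [m hm] := choice (fun j => posinv_bounds hip (hA j)).
have [M hM] := choice hm.
have S1 : 0 <= \sum_j (m j)^-1.
  by apply: sumr_ge0 => j _; rewrite invr_ge0 ltW //; case: (hM j).
have S2 : 0 <= \sum_j M j by apply: sumr_ge0 => j _; rewrite ltW //; case: (hM j).
have le1 (F : 'I_n -> R) j : (forall i, 0 <= F i) -> F j <= \sum_i F i.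
  by move=> F0; rewrite (bigD1 j) //= lerDl sumr_ge0.
(* Sums stand in for the maxima of the bounds; the added 1 gives m <= 1 <= M. *)
exists (1 + \sum_j (m j)^-1)^-1, (1 + \sum_j M j); split.
- by rewrite invr_gt0; lra.
- lra.
- by apply: (@le_trans _ _ 1); [rewrite invf_le1; lra | lra].
- move=> j; have [m0 _ h _] := hM j; apply: ople_trans h; apply: ople_scalar => //.
  rewrite -[leRHS]invrK lef_pV2 ?posrE ?invr_gt0 //; last lra.
  have := @le1 (fun j => (m j)^-1) j => /(_ _) h; apply: le_trans (h _) _; last lra.
  by move=> i; rewrite invr_ge0 ltW //; case: (hM i).
- move=> j; have [_ _ _ h] := hM j; apply: (ople_trans h); apply: ople_scalar => //.
  have := @le1 M j => /(_ _) h'; apply: le_trans (h' _) _; last lra.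
  by move=> i; rewrite ltW //; case: (hM i).
Qed.

(** By Young's inequality the factor t^(q^k) is at most 1 + q^k (t - 1), and q < 1 makes the excess
    vanish in the limit. *)
Lemma ople_of_powers t X Y : 1 <= t -> selfadj ip X -> posinv Y ->
  (forall k : nat, X ⊑ (t `^ (q ^+ k)) *: Y) -> X ⊑ Y.
Proof.
move=> t1 hX hY h; have [_ [K [_ K0 _ hK]]] := posinv_bounds hip hY.
apply: (@ople_eps _ _ _ _ hip _ _ ((t - 1) * K)) => //; first exact: posinv_selfadj.
move=> e e0; have [N hN] := expr_small q0 q1 e0.
apply: (ople_trans (h N)); have qN := hN N (leqnn N).
have qI : 0 <= q ^+ N <= 1 by rewrite exprn_ge0 // exprn_ile1 // ltW.
have tb : t `^ (q ^+ N) <= 1 + e * (t - 1).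
  have t0 : 0 < t by lra.
  have := powR_young qI t0.
  have t2 : 0 <= t - 1 by lra.
  have := ler_wpM2r t2 qN; lra.
apply: (ople_trans (opleZr (posinv_pos hY) tb)).
rewrite scalerDl scale1r; apply: opleD; first exact: ople_refl.
rewrite [e * (_ * K)]mulrA -[X in _ ⊑ X]scalerA; apply: opleZ hK.
by apply: mulr_ge0; rewrite ?subr_ge0 // ltW.
Qed.

(** An order version of the contraction principle: positive scalar bounds for X and Y give an
    initial ratio t >= 1, and iterating the hypothesis improves it to t^(q^k). *)
Lemma contraction_le X Y : posinv X -> posinv Y ->
  (forall t, 0 < t -> X ⊑ t *: Y -> X ⊑ t `^ q *: Y) -> X ⊑ Y.
Proof.
move=> hX hY h; have [_ [M [_ M0 _ uM]]] := posinv_bounds hip hX.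
have [m [_ [m0 _ lm _]]] := posinv_bounds hip hY.
pose t := M / m + 1; have Mm : 0 < M / m by rewrite divr_gt0.
have t1 : 1 <= t by rewrite /t; lra.
apply: (@ople_of_powers t) => //; first exact: posinv_selfadj.
elim=> [|k ih].
  rewrite expr0 powRr1; last lra.
  apply: (ople_trans uM).
  have -> : M%:A = (M / m) *: (m%:A : E) by rewrite scalerA divfK // gt_eqF.
  apply: (ople_trans (opleZ (ltW Mm) lm)); apply: opleZr; last by rewrite /t; lra.
  exact: posinv_pos.
by rewrite exprSr powRrM; apply: h ih; rewrite powR_gt0 //; lra.
Qed.

(** If X ⊑ t P, then X ⊑ f(X) ⊑ f(t P) = t^q P for f = [mean_map A], so [contraction_le] applies. *)
Lemma sub_fixpoint_le A X P : (forall j, posinv (A j)) -> posinv X -> posinv P ->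
  P = mean_map A P -> X ⊑ mean_map A X -> X ⊑ P.
Proof.
move=> hA hX hP eP h; apply: contraction_le => // t t0 ht.
by apply: (ople_trans h); rewrite {1}eP -mean_map_scale //; exact: mean_map_mono.
Qed.

Lemma super_fixpoint_ge A X P : (forall j, posinv (A j)) -> posinv X -> posinv P ->
  P = mean_map A P -> mean_map A X ⊑ X -> P ⊑ X.
Proof.
move=> hA hX hP eP h; apply: contraction_le => // t t0 ht.
apply: ople_trans (opleZ (powR_ge0 _ _) h); rewrite -mean_map_scale // {1}eP.
exact: mean_map_mono.
Qed.

Lemma mean_map_fixpoint A : (forall j, posinv (A j)) -> exists2 X, posinv X & X = mean_map A X.
Proof.
move=> hA; have [m [M [m0 M0 mM lA uA]]] := family_bounds hA.
pose x (k : nat) : E := iter k (mean_map A) M%:A.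
have xS k : x k.+1 = mean_map A (x k) by [].
have lx k : m%:A ⊑ x k.
  elim: k => [|k ih]; first exact: ople_scalar.
  by rewrite xS; exact: mean_map_ge.
have px k : posinv (x k) by exact: posinv_of_lower (lx k).
have ux k : x k ⊑ M%:A.
  elim: k => [|k ih]; first exact: ople_refl.
  by rewrite xS; exact: mean_map_upper.
have dec k l : x (k + l)%N ⊑ x k.
  elim: k => [|k ih]; first exact: ux.
  by rewrite addSn !xS; exact: mean_map_mono.
pose t := M / m; have t1 : 1 <= t by rewrite ler_pdivlMr // mul1r.
have t0 : 0 < t by lra.
(* The iterates start at M = t m and stay above m, which gives the ratio t at k = 0; each
   application of the map raises the ratio to the power q. *)
have contr k l : x k ⊑ t `^ (q ^+ k) *: x (k + l)%N.
  elim: k => [|k ih].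
    rewrite expr0 powRr1; last lra.
    have -> : x 0%N = t *: (m%:A : E) by rewrite /x /= scalerA /t divfK // gt_eqF.
    by apply: opleZ (lx _); lra.
  by rewrite exprSr powRrM addSn !xS -mean_map_scale ?powR_gt0 //; exact: mean_map_mono.
have young k : t `^ (q ^+ k) <= 1 + q ^+ k * (t - 1).
  have qI : 0 <= q ^+ k <= 1 by rewrite exprn_ge0 // exprn_ile1 // ltW.
  have := powR_young qI t0; lra.
(* Successive iterates from k on differ by at most q^k (t - 1) M; the 1 keeps the divisor positive
   when t = 1. *)
have C0 : 0 < (t - 1) * M + 1 by have := mulr_ge0 (_ : 0 <= t - 1) (ltW M0); lra.
have [X hX] : exists X, forall e, 0 < e ->
    exists N : nat, forall k : nat, (N <= k)%N -> bnd (x k - X) e.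
  apply: bop_complete => e e0.
  have [N hN] := expr_small q0 q1 (divr_gt0 e0 C0); exists N => k l.
  wlog kl : k l / (k <= l)%N => [hw hk hl|hk _].
    case/orP: (leq_total k l) => ?; first exact: hw.
    by apply: bndBC; exact: hw.
  rewrite -(subnKC kl); set i := (l - k)%N.
  apply: (bnd_ople hip) => //.
  - by apply: selfadjB; exact: posinv_selfadj.
  - apply: (@ople_trans _ _ _ _ 0); last by rewrite ople0; exact: dec.
    by rewrite -(scale0r (1 : E)); apply: ople_scalar => //; lra.
  have := ople_trans (contr k i) (opleZr (posinv_pos (px _)) (young k)).
  rewrite scalerDl scale1r => h.
  have h2 : x k - x (k + i)%N ⊑ (q ^+ k * (t - 1)) *: x (k + i)%N.
    by have := opleD h (ople_refl ip (- x (k + i)%N)); rewrite addrAC subrr add0r.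
  apply: (ople_trans h2); apply: (ople_trans (opleZ _ (ux _))).
    by rewrite mulr_ge0 ?exprn_ge0 // subr_ge0.
  rewrite scalerA; apply: ople_scalar => //.
  have := hN k hk; rewrite ler_pdivlMr // => h3; apply: le_trans h3.
  by rewrite -mulrA; apply: ler_wpM2l; [exact: exprn_ge0 | rewrite lerDl].
have sX : selfadj ip X.
  apply: (selfadj_lim hip) => e e0; have [N hN] := hX e e0.
  by exists (x N); split; [exact: posinv_selfadj | exact: hN].
have Xx k : X ⊑ x k.
  apply: (@ople_eps _ _ _ _ hip _ _ 1) => //; first exact: posinv_selfadj.
  move=> e e0; have [N hN] := hX e e0.
  have h := hN (k + N)%N (leq_addl _ _).
  rewrite mulr1; apply: (ople_trans (bnd_ople2 hip sX (posinv_selfadj (px (k + N)%N)) (bndBC h))).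
  by apply: opleD; [exact: dec | exact: ople_refl].
have mX : m%:A ⊑ X.
  apply: (@ople_eps _ _ _ _ hip _ _ 1) => //; first exact: selfadj_scalar.
  move=> e e0; have [N hN] := hX e e0; rewrite mulr1.
  by apply: (ople_trans (lx N)); apply: bnd_ople2 => //; [exact: posinv_selfadj | exact: hN].
have pX : posinv X by exact: posinv_of_lower mX.
have xX k : x k ⊑ t `^ (q ^+ k) *: X.
  apply: (@ople_eps _ _ _ _ hip _ _ (t `^ (q ^+ k))) => //; [exact: posinv_selfadj|exact: selfadjZ|].
  move=> e e0; have [N hN] := hX e e0.
  apply: (ople_trans (contr k N)); rewrite mulrC -[in X in _ ⊑ X]scalerA -scalerDr.
  apply: opleZ; first exact: powR_ge0.
  by apply: bnd_ople2 => //; [exact: posinv_selfadj | apply: hN; rewrite leq_addl].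
have pm : posinv (mean_map A X) by apply: (@posinv_of_lower _ _ _ _ hip _ m) => //; exact: mean_map_ge.
have tq k : t `^ (q ^+ k.+1) <= t `^ (q ^+ k).
  by apply: ler_powR => //; rewrite exprSr ler_piMr ?exprn_ge0 // ltW.
(* The limit is recognized through the order: X ⊑ x_(k+1) = f(x_k) and f(X) ⊑ f(x_k) = x_(k+1),
   while x_k exceeds X by a ratio of at most t^(q^k). *)
exists X => //; apply: (ople_anti hip); apply: (@ople_of_powers t) => //; try exact: posinv_selfadj.
  move=> k; apply: (ople_trans (Xx k.+1)).
  apply: (ople_trans (b := t `^ (q ^+ k.+1) *: mean_map A X)).
    by rewrite xS exprSr powRrM -mean_map_scale ?powR_gt0 //; exact: mean_map_mono.
  by apply: opleZr (tq k); exact: posinv_pos.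
move=> k; apply: (ople_trans (b := x k.+1)); first by rewrite xS; exact: mean_map_mono.
by apply: (ople_trans (xX _)); apply: opleZr (tq k); exact: posinv_pos.
Qed.

(** * Comparing the fixed points for a family and for its powers *)

Section Comparison.
Context (A : 'I_n -> E) (hA : forall j, posinv (A j)).
Context (X : E) (pX : posinv X) (eX : X = mean_map A X).
Context (lam : R) (lam0 : 0 < lam) (lamX : lam%:A ⊑ X).

Let pow_le s B : 0 <= s <= 1 -> posinv B -> lam `^ (1 - s) *: bpow B s ⊑ gmean s X B.
Proof.
move=> sI pB; rewrite -(gmean_scalar_l hip) //.
by apply: gmean_mono_l => //; exact: posinv_scalar.
Qed.

Let lamD r s : lam `^ r * lam `^ s = lam `^ (r + s).
Proof. by rewrite powRD // (gt_eqF lam0) implybT. Qed.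

Lemma power_mean_pow_le1 r Y : 0 < r -> r <= 1 -> posinv Y ->
  Y = mean_map (fun j => bpow (A j) r) Y -> Y ⊑ lam `^ (r - 1) *: X.
Proof.
move=> r0 r1 pY eY; have rI : 0 <= r <= 1 by rewrite r1 ltW.
have pAr j : posinv (bpow (A j) r) by exact: bpow_posinv.
have pl s : 0 < lam `^ s by exact: powR_gt0.
apply: super_fixpoint_ge eY _ => //; first exact: posinvZ.
rewrite mean_map_scale // -powRrM.
have h j : gmean al X (bpow (A j) r) ⊑
    lam `^ (al * (r - 1)) *: ((1 - r) *: X + r *: gmean al X (A j)).
  have le : bpow (A j) r ⊑ lam `^ (r - 1) *: gmean r X (A j).
    have := opleZ (ltW (pl (r - 1))) (pow_le rI (hA j)).
    rewrite scalerA lamD; have -> : r - 1 + (1 - r) = 0 by ring.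
    by rewrite powRr0 scale1r.
  apply: (ople_trans (gmean_mono_r hip alI pX (pAr j) le)).
  rewrite (gmean_scale_r hip) //; last exact: gmean_posinv.
  rewrite -powRrM [_ * al]mulrC; apply: opleZ; first exact: ltW.
  by rewrite (gmean_gm hip) // mulrC; exact: gmean_young.
have : mean_map (fun j => bpow (A j) r) X ⊑ lam `^ (al * (r - 1)) *: X.
  apply: (ople_trans (b := \sum_(j < n) w j *:
     (lam `^ (al * (r - 1)) *: ((1 - r) *: X + r *: gmean al X (A j))))).
    by apply: ople_sum => j; apply: opleZ; [exact: w_prob.1 | exact: h].
  have -> : \sum_(j < n) w j *: (lam `^ (al * (r - 1)) *: ((1 - r) *: X + r *: gmean al X (A j))) =
      lam `^ (al * (r - 1)) *: ((1 - r) *: (\sum_(j < n) w j *: X) + r *: mean_map A X).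
    rewrite /mean_map !scaler_sumr -big_split /= scaler_sumr; apply: eq_bigr => j _.
    by rewrite !scalerDr !scalerA; congr (_ *: _ + _ *: _); ring.
  by rewrite sum_weights -eX -scalerDl subrK scale1r; exact: ople_refl.
(* The exponents (r - 1) q, from homogeneity, and al (r - 1), from the estimate of the means, add up
   to r - 1. *)
move=> /(opleZ (ltW (pl ((r - 1) * q)))); rewrite scalerA lamD.
by rewrite [al * _]mulrC -mulrDr subrK mulr1.
Qed.

Lemma power_mean_pow_ge1 r Y : 1 <= r -> posinv Y ->
  Y = mean_map (fun j => bpow (A j) r) Y -> lam `^ (r - 1) *: X ⊑ Y.
Proof.
move=> r1 pY eY; have r0 : 0 < r by lra.
have pAr j : posinv (bpow (A j) r) by exact: bpow_posinv.
have pl s : 0 < lam `^ s by exact: powR_gt0.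
pose s := r^-1; have rs : r * s = 1 by rewrite mulfV // gt_eqF.
have s0 : 0 < s by rewrite invr_gt0.
have sI : 0 <= s <= 1 by rewrite ltW //= invf_le1.
clearbody s.
apply: sub_fixpoint_le eY _ => //; first exact: posinvZ.
rewrite mean_map_scale // -powRrM.
pose k := lam `^ (al * (1 - r)).
have k0 : 0 < k by exact: pl.
have h j : gmean al X (A j) ⊑ (1 - s) *: X + (s * k) *: gmean al X (bpow (A j) r).
  have Aj : A j = bpow (bpow (A j) r) s by rewrite (bpow_bpow hip) // rs (bpow1 hip).
  have le : A j ⊑ lam `^ (s - 1) *: gmean s X (bpow (A j) r).
    have := opleZ (ltW (pl (s - 1))) (pow_le sI (pAr j)).
    rewrite -Aj scalerA lamD; have -> : s - 1 + (1 - s) = 0 by ring.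
    by rewrite powRr0 scale1r.
  apply: (ople_trans (gmean_mono_r hip alI pX (hA j) le)).
  rewrite (gmean_scale_r hip) //; last exact: gmean_posinv.
  rewrite (gmean_gm hip) //.
  (* Young's inequality is applied to c A_j^r instead of A_j^r. Because r s = 1, c^(al s) is the
     factor lam^((s - 1) al) already present, so the scalar is absorbed and X keeps the coefficient
     1 - s. *)
  pose c := lam `^ (1 - r).
  have c0 : 0 < c by exact: pl.
  have := gmean_young hip pX (posinvZ c0 (pAr j)) al sI.
  rewrite !(gmean_scale_r hip) // -!powRrM scalerA [s * al]mulrC.
  have -> : (1 - r) * (al * s) = (s - 1) * al.
    have gen (t : R) : (1 - r) * (t * s) = t * (s - r * s) by ring.
    by rewrite gen rs mulrC.
  by rewrite [(1 - r) * al]mulrC.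
have : X ⊑ k *: mean_map (fun j => bpow (A j) r) X.
  have h1 : X ⊑ (1 - s) *: X + (s * k) *: mean_map (fun j => bpow (A j) r) X.
    rewrite {1}eX; apply: (ople_trans (b := \sum_(j < n) w j *:
       ((1 - s) *: X + (s * k) *: gmean al X (bpow (A j) r)))).
      by apply: ople_sum => j; apply: opleZ; [exact: w_prob.1 | exact: h].
    have -> : \sum_(j < n) w j *: ((1 - s) *: X + (s * k) *: gmean al X (bpow (A j) r)) =
        (1 - s) *: (\sum_(j < n) w j *: X) + (s * k) *: mean_map (fun j => bpow (A j) r) X.
      rewrite /mean_map !scaler_sumr -big_split /=; apply: eq_bigr => j _.
      by rewrite !scalerDr !scalerA; congr (_ *: _ + _ *: _); ring.
    by rewrite sum_weights; exact: ople_refl.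
  (* Subtracting (1 - s) X leaves s X on the left, and s is then cancelled by multiplying with r. *)
  have h2 : s *: X ⊑ (s * k) *: mean_map (fun j => bpow (A j) r) X.
    have := opleD h1 (ople_refl ip (- ((1 - s) *: X))).
    rewrite addrAC subrr add0r -{1}[X]scale1r -scalerBl.
    by have -> : 1 - (1 - s) = s by ring.
  have := opleZ (ltW r0) h2; rewrite !scalerA rs scale1r mulrA rs mul1r //.
move=> /(opleZ (ltW (pl (r - 1)))); rewrite scalerA lamD.
have gen (t : R) : r - 1 + t * (1 - r) = (r - 1) * (1 - t) by ring.
by rewrite gen.
Qed.

End Comparison.
End PowerMean.

(** * Power means of both signs and the scalars in the bounds *)

Section PowerMeans.
Context {R : realType} {H : completeNormedModType R[i]}.
Context (hn : exists x : H, x != 0).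
Context (ip : {dot H for Num.conj}) (hip : norm_of_inner_product ip).
Local Notation E := (bop hn).
Local Notation "a ⊑ b" := (ople ip a b) (at level 70).
Local Notation posinv := (posinv ip).
Context (n : nat) (w : 'I_n -> R) (w_prob : probability_vector w).
Context (al : R) (al0 : 0 < al) (al1 : al <= 1).
Implicit Types (a b X Y : E) (r : R) (A : 'I_n -> E).

Lemma pos_invertibleP (B : H -> H) :
  pos_invertible ip B <-> exists2 b : E, B = b & posinv b.
Proof.
split=> [[bB pB iB]|[b -> [pb ub]]].
  exists (Bop hn bB) => //; split; first exact/positive_operatorP.
  exact/invertible_unit.
split; [exact: bopP | exact/positive_operatorP | exact/invertible_unit].
Qed.

Lemma mean_map_posinv A X : (forall j, posinv (A j)) -> posinv X -> posinv (mean_map w al A X).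
Proof.
move=> hA hX; have [m [_ [m0 _ _ lA _]]] := family_bounds hip hA.
have [k k0 lX] := posinv_lower hip hX.
have mk0 : 0 < Num.min m k by rewrite lt_min m0.
apply: (posinv_of_lower hip mk0); apply: mean_map_ge => //.
  by apply: ople_trans lX; apply: ople_scalar => //; rewrite ge_min lexx orbT.
by move=> j; apply: ople_trans (lA j); apply: ople_scalar => //; rewrite ge_min lexx.
Qed.

Lemma power_mean_equationP A X : (forall j, posinv (A j)) -> posinv X ->
  power_mean_equation w al (fun j => A j) X <-> X = mean_map w al A X.
Proof.
move=> hA hX; rewrite /power_mean_equation al0.
have -> : (fun x => \sum_(j < n) (w j)%:C *: geometric_mean al X (A j) x) =
    mean_map w al A X :> (H -> H).
  apply: funext => x; rewrite /mean_map bop_sum; apply: eq_bigr => j _.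
  by rewrite (geometric_meanE hip).
by split=> [/bop_inj | {1}->].
Qed.

Lemma power_mean_equationN A X : (forall j, posinv (A j)) -> posinv X ->
  power_mean_equation w (- al) (fun j => A j) X <->
  X^-1 = mean_map w al (fun j => (A j)^-1) X^-1.
Proof.
move=> hA hX; rewrite /power_mean_equation oppr_gt0 ltNge (ltW al0) /= opprK.
have hAV j : posinv (A j)^-1 by exact: posinvV.
have -> : (fun x => \sum_(j < n) (w j)%:C *: opinv (geometric_mean al X (A j)) x) =
    mean_map w al (fun j => (A j)^-1) X^-1 :> (H -> H).
  apply: funext => x; rewrite /mean_map bop_sum; apply: eq_bigr => j _.
  have hg := gmean_posinv hip hX (hA j) al.
  by rewrite (geometric_meanE hip) // (opinv_bop (posinv_unit hg)) (gmean_inv hip).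
have hp : posinv (mean_map w al (fun j => (A j)^-1) X^-1).
  by apply: mean_map_posinv => //; exact: posinvV.
rewrite (opinv_bop (posinv_unit hp)).
by split=> [/bop_inj {1}-> | {1}<-]; rewrite invrK.
Qed.

Lemma power_meanE A : (forall j, posinv (A j)) ->
  exists2 X : E, power_mean ip w al (fun j => A j) = X &
    posinv X /\ X = mean_map w al A X.
Proof.
move=> hA; rewrite /power_mean; case: xgetP => [B _ [/pos_invertibleP [X -> hX] eX]|h].
  by exists X => //; split=> //; exact/power_mean_equationP.
have [X hX eX] := mean_map_fixpoint hip w_prob al0 al1 hA.
case: (h X); split; first by apply/pos_invertibleP; exists X.
exact/power_mean_equationP.
Qed.

Lemma power_meanN A : (forall j, posinv (A j)) ->
  exists2 X : E, power_mean ip w (- al) (fun j => A j) = X &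
    posinv X /\ X^-1 = mean_map w al (fun j => (A j)^-1) X^-1.
Proof.
move=> hA; rewrite /power_mean; case: xgetP => [B _ [/pos_invertibleP [X -> hX] eX]|h].
  by exists X => //; split=> //; exact/power_mean_equationN.
have hAV j : posinv (A j)^-1 by exact: posinvV.
have [Y hY eY] := mean_map_fixpoint hip w_prob al0 al1 hAV.
have hYV : posinv Y^-1 by exact: posinvV.
case: (h Y^-1); split; first by apply/pos_invertibleP; exists Y^-1.
by apply/power_mean_equationN => //; rewrite invrK.
Qed.

(** [rspec_inf] yields a spectral point that is also a lower bound of X. Being the least element of
    the spectrum it is unique, so [xget] returns it and not the default 0. *)
Lemma lambda_min_lower X : posinv X -> 0 < lambda_min X /\ (lambda_min X)%:A ⊑ X.
Proof.
move=> hX; have sX := posinv_selfadj hX; have [m hm lm] := rspec_inf hip sX.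
have m0 := rspec_posinv hip hX hm.
suff -> : lambda_min X = m by [].
have hS : spectrum X m%:C /\ forall z, spectrum X z -> m%:C <= z.
  split; first exact/spectrum_rspec.
  move=> z sz; have zr := selfadj_spectrum_real hip sX sz.
  rewrite zr lecR; apply: (rspec_lower hip lm); apply/spectrum_rspec.
  by rewrite -zr.
rewrite /lambda_min; case: xgetP => [m' _ [s1 s2]|/(_ m)] //.
by apply/eqP; rewrite eq_le -!lecR s2 ?hS.2 //; exact: hS.1.
Qed.

(** For exponent -alpha the comparison is made between inverses, and this scalar serves there as the
    lower bound [lam]. *)
Lemma opnorm_inv_lower X : posinv X -> 0 < opnorm X /\ (opnorm X)^-1%:A ⊑ X^-1.
Proof.
move=> hX; have sX := posinv_selfadj hX; have [m hm lm] := rspec_inf hip sX.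
have m0 := rspec_posinv hip hX hm.
have uX : X ⊑ (opnorm X)%:A by apply: (ople_bnd hip) => //; exact: bnd_opnorm.
have N0 : 0 < opnorm X by apply: lt_le_trans m0 _; exact: (rspec_upper hip uX hm).
split=> //; have := ople_inv hip hX uX.
have uN : opnorm X \is a GRing.unit by rewrite unitfE gt_eqF.
by rewrite invrZ ?unitr1 // invr1.
Qed.

End PowerMeans.

Theorem corollary3p3 (R : realType) (H : completeNormedModType R[i])
    (ip : {dot H for Num.conj})
    (H_hilbert : norm_of_inner_product ip)
    (H_infinite : infinite_dimensional H)
    (n : nat) (w : 'I_n -> R) (w_prob : probability_vector w)
    (alpha : R) (alpha_gt0 : 0 < alpha) (alpha_le1 : alpha <= 1)
    (A : 'I_n -> H -> H) (A_pos : forall j, pos_invertible ip (A j)) :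
  (forall r : R, 1 <= r ->
     op_le ip
       (fun x => ((lambda_min (power_mean ip w alpha A)) `^ (r - 1))%:C
                   *: power_mean ip w alpha A x)
       (power_mean ip w alpha (fun j => oppow (A j) r)) /\
     op_le ip
       (power_mean ip w (- alpha) (fun j => oppow (A j) r))
       (fun x => ((opnorm (power_mean ip w (- alpha) A)) `^ (r - 1))%:C
                   *: power_mean ip w (- alpha) A x)) /\
  (forall r : R, 0 < r -> r <= 1 ->
     op_le ip
       (power_mean ip w alpha (fun j => oppow (A j) r))
       (fun x => ((lambda_min (power_mean ip w alpha A)) `^ (r - 1))%:C
                   *: power_mean ip w alpha A x) /\
     op_le ip
       (fun x => ((opnorm (power_mean ip w (- alpha) A)) `^ (r - 1))%:C
                   *: power_mean ip w (- alpha) A x)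
       (power_mean ip w (- alpha) (fun j => oppow (A j) r))).
Proof.
(* Infinite dimension, applied to the empty family, gives a vector different from the empty sum. *)
have hn : exists x : H, x != 0.
  have [x hx] := H_infinite [::]; exists x; apply/eqP => x0.
  by apply: (hx (fun=> 0)); rewrite big_ord0.
have [a ha] : exists a : 'I_n -> bop hn, forall j, A j = a j /\ posinv ip (a j).
  have h j : exists b : bop hn, A j = b /\ posinv ip b.
    by have /(pos_invertibleP hn ip) [b ? ?] := A_pos j; exists b.
  by have [a ha] := choice h; exists a.
have pa j : posinv ip (a j) := (ha j).2.
have -> : A = (fun j => a j : H -> H) by apply: funext => j; case: (ha j).
have powE r : (fun j => oppow (a j) r) = (fun j => bpow (a j) r : H -> H).
  by apply: funext => j; exact: oppow_bpow (pa j).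
have pb r j : posinv ip (bpow (a j) r) by exact: bpow_posinv.
have paV j : posinv ip (a j)^-1 by exact: posinvV.
have bV r : (fun j => (bpow (a j) r)^-1) = (fun j => bpow (a j)^-1 r).
  by apply: funext => j; rewrite (bpowV H_hilbert) // (bpowN H_hilbert).
have [X -> [pX eX]] := power_meanE H_hilbert w_prob alpha_gt0 alpha_le1 pa.
have [Y -> [pY eY]] := power_meanN H_hilbert w_prob alpha_gt0 alpha_le1 pa.
have [l0 lX] := lambda_min_lower H_hilbert pX.
have [N0 NY] := opnorm_inv_lower H_hilbert pY.
have pYV := posinvV pY.
have NV0 : 0 < (opnorm Y)^-1 by rewrite invr_gt0.
(* The comparison operator for the inverses, lam^(r-1) Y^-1 with lam the inverse of [opnorm Y], is
   the inverse of the bound in the statement; inverting reverses the inequalities. *)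
have scaleV r : ((opnorm Y)^-1 `^ (r - 1) *: Y^-1)^-1 = (opnorm Y) `^ (r - 1) *: Y.
  have p0 : 0 < (opnorm Y) `^ (r - 1) by exact: powR_gt0.
  have -> : (opnorm Y)^-1 `^ (r - 1) = ((opnorm Y) `^ (r - 1))^-1.
    by rewrite -powR_inv1 ?ltW // -powRrM mulN1r powRN.
  by rewrite invrZ ?(posinv_unit pYV) ?invrK // unitfE gt_eqF // invr_gt0.
have pZ r : posinv ip ((opnorm Y)^-1 `^ (r - 1) *: Y^-1).
  by apply: posinvZ => //; exact: powR_gt0.
split=> [r r1|r r0 r1]; rewrite powE;
  have [X' -> [pX' eX']] := power_meanE H_hilbert w_prob alpha_gt0 alpha_le1 (pb r);
  have [Y' -> [pY' eY']] := power_meanN H_hilbert w_prob alpha_gt0 alpha_le1 (pb r);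
  rewrite bV in eY'; have pYV' := posinvV pY'; split.
- apply/(op_leP ip (_ *: X) X').
  exact: (power_mean_pow_ge1 H_hilbert w_prob alpha_gt0 alpha_le1 pa pX eX).
- apply/(op_leP ip Y' (_ *: Y)); rewrite -scaleV -[Y']invrK.
  apply: (ople_inv H_hilbert (pZ r)).
  exact: (power_mean_pow_ge1 H_hilbert w_prob alpha_gt0 alpha_le1 paV pYV eY).
- apply/(op_leP ip X' (_ *: X)).
  exact: (power_mean_pow_le1 H_hilbert w_prob alpha_gt0 alpha_le1 pa pX eX).
- apply/(op_leP ip (_ *: Y) Y'); rewrite -scaleV -[Y']invrK.
  apply: (ople_inv H_hilbert pYV').
  exact: (power_mean_pow_le1 H_hilbert w_prob alpha_gt0 alpha_le1 paV pYV eY).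
Qed.
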